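(* (a) If $f:[-1,1]\to\mathbb{R}$ belongs to $HBV$ on $[-1,1]$ and has finitely many discontinuities, then for each fixed $x\in(-1,1)$, $$\lim_{n\to\infty}n\left[R_n^{(-\frac12,-\frac12)}(f;x)\right]^{(-1)}=-\frac{(1-x^2)^{1/2}}{\pi}\bigl(f(x+0)-f(x-0)\bigr),\qquad(\ast)$$ where $$\left[R_n^{(-\frac12,-\frac12)}(f;x)\right]^{(-1)}=\int_{-1}^{x}R_n^{(-\frac12,-\frac12)}(f;y)\,dy$$ and $R_n^{(-\frac12,-\frac12)}(f;\cdot)$ is the $n$th order tail of the Fourier-Chebyshev series of $f$. (b) If $f:[-1,1]\to\mathbb{R}$ belongs to $V_2$ on $[-1,1]$, then $(\ast)$ holds for each fixed $x\in(-1,1)$ without any restriction on the number of discontinuities of $f$.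
   Context: For a function $f$ and an interval $I=[a,b]$ write $f(I)=f(b)-f(a)$. $f\in HBV$ on $[-1,1]$ (harmonic bounded variation) means $\sup\sum_i|f(I_i)|/i<\infty$, and $f\in V_2$ on $[-1,1]$ (bounded $2$-variation in Wiener's sense) means $\sup\bigl\{\sum_i|f(I_i)|^2\bigr\}^{1/2}<\infty$; both suprema are over all finite collections $I_1,I_2,\dots$ (in any order) of nonoverlapping subintervals of $[-1,1]$. Functions in these classes have one-sided limits $f(x\pm0)$ at each point. Let $P_k$, $k\ge0$, be the polynomials of degree $k$ with positive leading coefficient, orthonormal on $[-1,1]$ with respect to the Chebyshev weight $w(t)=(1-t)^{-1/2}(1+t)^{-1/2}$, i.e. $\int_{-1}^1P_nP_m w\,dt=\delta_{nm}$. With $a_k(f)=\int_{-1}^1f(t)P_k(t)w(t)\,dt$, the Fourier-Chebyshev series of $f$ is $\sum_{k\ge0}a_k(f)P_k(x)$, and its $n$th order tail is $R_n^{(-\frac12,-\frac12)}(f;x)=\sum_{k=n}^{\infty}a_k(f)P_k(x)$. *)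

(* Defs.v *)
From HB Require Import structures.
From mathcomp Require Import all_boot all_order all_algebra.
From mathcomp Require Import all_classical all_reals all_analysis.
Set Implicit Arguments.
Unset Strict Implicit.
Unset Printing Implicit Defensive.
Import Order.TTheory GRing.Theory Num.Theory.
Import numFieldNormedType.Exports.
Local Open Scope classical_set_scope.
Local Open Scope ring_scope.

(* A finite collection I_1, I_2, ... is a sequence of pairs I = (I.1, I.2) of
   endpoints, in any order. Intervals are non-degenerate, so the disjunction in
   [pairwise] says exactly that two of them have disjoint interiors. *)
Definition nonoverlapping (R : realType) (a b : R) (s : seq (R * R)) : bool :=
  all (fun I => [&& a <= I.1, I.1 < I.2 & I.2 <= b]) s &&
  pairwise (fun I J => (I.2 <= J.1) || (J.2 <= I.1)) s.

Definition increment (R : realType) (f : R -> R) (I : R * R) : R :=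
  f I.2 - f I.1.

(* The sequence is 0-based, hence the denominator [i.+1]. *)
Definition harmonic_sum (R : realType) (f : R -> R) (s : seq (R * R)) : R :=
  \sum_(i < size s) `|increment f (nth (0, 0) s i)| / i.+1%:R.

Definition quadratic_sum (R : realType) (f : R -> R) (s : seq (R * R)) : R :=
  \sum_(I <- s) `|increment f I| ^+ 2.

Definition HBV (R : realType) (a b : R) (f : R -> R) : Prop :=
  has_ubound [set harmonic_sum f s | s in [set s | nonoverlapping a b s]].

Definition V2 (R : realType) (a b : R) (f : R -> R) : Prop :=
  has_ubound
    [set Num.sqrt (quadratic_sum f s) | s in [set s | nonoverlapping a b s]].

(* Discontinuity is relative to [a, b]: values outside it play no role. *)
Definition discontinuities (R : realType) (a b : R) (f : R -> R) : set R :=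
  [set t | t \in `[a, b] /\ ~ (f y @[y --> within `[a, b] (nbhs t)] --> f t)].

(* At t = 1 and t = -1, [powR] gives the value 0 instead of +oo. *)
Definition chebyshev_weight (R : realType) (t : R) : R :=
  (1 - t) `^ (- 2^-1) * (1 + t) `^ (- 2^-1).

Definition chebyshev_orthonormal (R : realType) (P : nat -> {poly R}) : Prop :=
  [/\ forall k, size (P k) = k.+1,
      forall k, 0 < lead_coef (P k) &
      forall n m,
        \int[lebesgue_measure]_(t in `[-1, 1])
          ((P n).[t] * (P m).[t] * chebyshev_weight t) = (n == m)%:R].

Definition fourier_chebyshev_coef (R : realType) (P : nat -> {poly R})
    (f : R -> R) (k : nat) : R :=
  \int[lebesgue_measure]_(t in `[-1, 1])
    (f t * (P k).[t] * chebyshev_weight t).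

Definition chebyshev_tail (R : realType) (P : nat -> {poly R})
    (f : R -> R) (n : nat) (x : R) : R :=
  limn (fun N => \sum_(n <= k < N) fourier_chebyshev_coef P f k * (P k).[x]).

Definition chebyshev_tail_primitive (R : realType) (P : nat -> {poly R})
    (f : R -> R) (n : nat) (x : R) : R :=
  \int[lebesgue_measure]_(y in `[-1, x]) chebyshev_tail P f n y.

Definition jump (R : realType) (f : R -> R) (x : R) : R :=
  lim (f y @[y --> x^'+]) - lim (f y @[y --> x^'-]).

Definition tail_detects_jump (R : realType) (P : nat -> {poly R})
    (f : R -> R) (x : R) : Prop :=
  n%:R * chebyshev_tail_primitive P f n x @[n --> \oo]
    --> - (Num.sqrt (1 - x ^+ 2) / pi) * jump f x.

(* Main.v *)
(* With y = cos phi and g = f o cos, the series becomes the Fourier cosine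
   series of g. Fix th in (0, pi). If a kernel on [0, pi] is O(n) and
   O(1 / |phi - th|), and its primitive varies by O(1 / (n |phi - th|)) beyond
   phi, then cutting [0, pi] at th + i d / n and summing by parts bounds the
   integral of g times the kernel, up to its expected contribution from
   g(th + 0) and g(th - 0), by sums of the form sum_i |g(I_i)| / i over adjacent
   intervals I_i; these tend to 0 because g has bounded harmonic variation.
   For the Dirichlet kernel this gives pointwise convergence, hence the tail
   R_n = f - S_n almost everywhere; for (1/n) sum_k k sin(k th) cos(k phi) it
   gives (1/n) sum_{k <= n} k c_k sin(k th) -> (f(x+0) - f(x-0)) / pi, with c_k
   the Fourier coefficients of g. Finally, the primitives Q_n of the tails tend
   to 0 (by pointwise convergence and Bessel's inequality), and
   Q_n - Q_{n+1} = - c_n (sin th sin(n th) / n + O(1/n^2)), so a summation by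
   parts and the Stolz-Cesaro theorem turn the previous limit into the limit
   of n Q_n. V_2 is contained in HBV by the inequality 2 u v <= u^2 + v^2. *)
Require Import Defs.
From mathcomp Require Import all_boot all_order all_algebra.
From mathcomp Require Import all_classical all_reals all_analysis.
From mathcomp Require Import measurable_realfun.
From mathcomp Require Import ring lra.
Import Order.TTheory GRing.Theory Num.Theory.
Import numFieldNormedType.Exports.
Local Open Scope classical_set_scope.
Local Open Scope ring_scope.

Set Implicit Arguments.
Unset Strict Implicit.
Unset Printing Implicit Defensive.

(** The mesh 1/n is forced by the kernel bounds: on the i-th cell the bound O(1 / |phi - th|) times
    the cell length is O(1 / i), the very weight of the harmonic sums, while the cell touching th is
    settled by O(n) and the one-sided limit. That these sums become small, not just bounded, rests
    on two facts: harmonic sums over intervals close to th but not touching it are small, and n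
    disjoint increments add up to o(n). Since g need not have bounded variation, integration against
    dg is avoided; all that is asked of integrals is that g may be frozen to a constant on each
    cell. As for the value of the limit, c_n merely tends to 0, so only averages control Q_n. If
    sum_{k <= m} k c_k sin(k th) grows like l m, with l the jump over pi, then the leading part -
    sin th * sum_{k >= n} (k c_k sin(k th)) / k^2 of Q_n behaves like - sin th * l * sum_{k >= n} 1
    / k^2, that is - sin th * l / n. The error O(1 / k^2) of each step is multiplied by c_k and
    therefore sums to o(1 / n). *)

Section HarmonicVariation.
Context {R : realType}.
Implicit Types (f : R -> R) (a b d e : R) (s : seq (R * R)).

Lemma harmonic_sum_cat f s s' : harmonic_sum f (s ++ s') = harmonic_sum f s +
  \sum_(i < size s') `|increment f (nth (0, 0) s' i)| / (size s + i).+1%:R.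
Proof.
rewrite /harmonic_sum size_cat big_split_ord /=; congr (_ + _).
  by apply: eq_bigr => i _; rewrite nth_cat ltn_ord.
by apply: eq_bigr => i _; rewrite nth_cat ltnNge leq_addr /= addKn.
Qed.

Lemma nonoverlapping_cat a b d s s' :
  nonoverlapping d b s -> nonoverlapping a d s' -> a <= d -> d <= b ->
  nonoverlapping a b (s ++ s').
Proof.
move=> /andP[/allP hs ps] /andP[/allP hs' ps'] ad db; apply/andP; split.
  rewrite all_cat; apply/andP; split; apply/allP => I.
    by move=> /hs /and3P[h1 -> ->]; rewrite (le_trans ad h1).
  by move=> /hs' /and3P[-> -> h]; rewrite (le_trans h db).
rewrite pairwise_cat ps ps' !andbT; apply/allrelP => I J /hs /and3P[h1 _ _].
by move=> /hs' /and3P[_ _ h2]; rewrite (le_trans h2 h1) orbT.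
Qed.

Lemma nonoverlapping_sub a b a' b' s : a' <= a -> b <= b' ->
  nonoverlapping a b s -> nonoverlapping a' b' s.
Proof.
move=> aa bb /andP[/allP hs ps]; apply/andP; split=> //; apply/allP => I.
by move=> /hs /and3P[h1 -> h2]; rewrite (le_trans aa h1) (le_trans h2 bb).
Qed.

Lemma HBV_ub a b f : HBV a b f ->
  exists2 C, 0 < C & forall s, nonoverlapping a b s -> harmonic_sum f s <= C.
Proof.
move=> [C hC]; exists (Num.max C 1); first by rewrite lt_max ltr01 orbT.
by move=> s hs; rewrite le_max hC//; exists s.
Qed.

Lemma HBV_sub a b a' b' f : a <= a' -> b' <= b -> HBV a b f -> HBV a' b' f.
Proof.
move=> aa bb [C hC]; exists C => _ [s hs <-]; apply: hC; exists s => //.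
exact: nonoverlapping_sub hs.
Qed.

(** The list keeps its order and only the endpoints of each interval are exchanged, so every
    increment keeps its weight. Used for [cos] on [0, pi] and for reflections. *)
Lemma HBV_antitone a b a' b' (m : R -> R) f :
  {in `[a', b'] &, {mono m : x y /~ x < y}} ->
  {in `[a', b'], forall x, m x \in `[a, b]} ->
  HBV a b f -> HBV a' b' (f \o m).
Proof.
move=> mm mab [C hC]; exists C => _ [s /andP[/allP hs ps] <-].
have mle : {in `[a', b'] &, {mono m : x y /~ x <= y}}.
  by move=> x y hx hy; rewrite leNgt mm// -leNgt.
have hI I : I \in s -> (I.1 \in `[a', b']) /\ (I.2 \in `[a', b']).
  move=> /hs /and3P[h1 h2 h3]; rewrite !in_itv/= h1 h3.
  by rewrite (le_trans (ltW h2) h3) (le_trans h1 (ltW h2)).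
have -> : harmonic_sum (f \o m) s =
    harmonic_sum f [seq (m u.2, m u.1) | u : R * R <- s].
  rewrite /harmonic_sum size_map; apply: eq_bigr => i _.
  by rewrite (nth_map (0, 0))// /increment/= distrC.
apply: hC; exists [seq (m u.2, m u.1) | u : R * R <- s] => //; apply/andP; split.
  rewrite all_map; apply/allP => I Is /=; have [h1 h2] := hI _ Is.
  have /andP[-> _] : a <= m I.2 <= b by have := mab _ h2; rewrite in_itv.
  have /andP[_ ->] : a <= m I.1 <= b by have := mab _ h1; rewrite in_itv.
  by rewrite mm//; have /and3P[_ -> _] := hs _ Is.
rewrite pairwise_map; apply/(pairwiseP (0, 0)) => i j.
rewrite !inE => hi hj ij /=.
have /(pairwiseP (0, 0))/(_ i j) := ps; rewrite !inE => /(_ hi hj ij) /=.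
have [i1 i2] := hI _ (mem_nth (0, 0) hi).
have [j1 j2] := hI _ (mem_nth (0, 0) hj).
by rewrite !mle// orbC.
Qed.

(** Whatever their order, [N] increments of size at least [e] contribute at least [e] times the
    [N]-th partial sum of the harmonic series, which diverges. *)
Lemma HBV_count a b f e : HBV a b f -> 0 < e -> exists N, forall s,
  nonoverlapping a b s -> all (fun I => e <= `|increment f I|) s ->
  (size s <= N)%N.
Proof.
move=> /HBV_ub[C C0 hC] e0.
have [N hN] : exists N, C / e < series (@harmonic R) N.
  apply: contra_notP (@dvg_harmonic R) => hN.
  apply: nondecreasing_is_cvgn.
    apply/nondecreasing_seqP => n; rewrite /series/= big_nat_recr//= lerDl.
    by rewrite invr_ge0.
  exists (C / e) => _ [n _ <-]; rewrite leNgt; apply/negP => h.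
  by apply: hN; exists n.
exists N => s hs /allP he; rewrite leqNgt; apply/negP => Ns.
have := hC _ hs; rewrite leNgt => /negP; apply.
move: hN; rewrite ltr_pdivrMr// => hN; apply: (lt_le_trans hN).
rewrite /series/= big_mkord mulr_suml /harmonic_sum.
rewrite (big_ord_widen _ (fun i => (i.+1%:R)^-1 * e) (ltnW Ns)) big_mkcond/=.
apply: ler_sum => i _; case: ifP => _; last by rewrite divr_ge0.
by rewrite mulrC ler_wpM2r ?invr_ge0// he// mem_nth.
Qed.

Lemma nonoverlapping_filter a b (p : pred (R * R)) s :
  nonoverlapping a b s -> nonoverlapping a b [seq u <- s | p u].
Proof.
move=> /andP[h1 h2]; rewrite /nonoverlapping pairwise_filter// andbT.
by apply/allP => I; rewrite mem_filter => /andP[_]; apply: (allP h1).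
Qed.

Lemma nonoverlapping1 a b x y : a <= x -> x < y -> y <= b ->
  nonoverlapping a b [:: (x, y)].
Proof. by move=> h1 h2 h3; rewrite /nonoverlapping/= h1 h2 h3. Qed.

Lemma HBV_bounded a b f : HBV a b f ->
  exists2 C, 0 < C & {in `[a, b] &, forall x y, `|f x - f y| <= C}.
Proof.
move=> /HBV_ub[C C0 hC]; exists C => //.
have hw x y : a <= x -> x < y -> y <= b -> `|f x - f y| <= C.
  move=> h1 h2 h3; have := hC _ (nonoverlapping1 h1 h2 h3).
  by rewrite /harmonic_sum big_ord1/= /increment/= divr1 distrC.
move=> x y; rewrite !in_itv/= => /andP[h1 h2] /andP[h3 h4].
case: (ltgtP x y) => [xy|xy|->]; first exact: hw.
  by rewrite distrC hw.
by rewrite subrr normr0 ltW.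
Qed.

(** Otherwise every right neighbourhood of [a] contains two points whose values differ by at least
    [e]. Picking such pairs closer and closer to [a] yields any number of disjoint intervals with
    large increments, against [HBV_count]. *)
Lemma HBV_right_cauchy a b f e : a < b -> HBV a b f -> 0 < e ->
  exists2 d, a < d <= b & {in `]a, d[ &, forall x y, `|f x - f y| < e}.
Proof.
move=> ab hf e0; apply: contrapT => hn.
have [N hN] := HBV_count hf e0.
suff H (n : nat) d : a < d <= b -> exists s, [/\ nonoverlapping a d s,
    exists2 d', a < d' <= d & all (fun I => d' <= I.1) s,
    all (fun I => e <= `|increment f I|) s & size s = n].
  have [|s [hs _ h1 h2]] := H N.+1 b; first by rewrite ab lexx.
  by have := hN s hs h1; rewrite h2 ltnn.
elim: n d => [|n IH] d /andP[ad db].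
  by exists [::]; split=> //; exists d; rewrite ?ad ?lexx.
have [|s [hs [d' /andP[ad' d'd] h1] h2 h3]] := IH d; first by rewrite ad.
have [x [y [ax xy yd he]]] : exists x, exists y,
    [/\ a < x, x < y, y < d' & e <= `|f x - f y|].
  apply: contrapT => hx; apply: hn; exists d'.
    by rewrite ad' (le_trans d'd).
  have hw x y : a < x -> x < y -> y < d' -> `|f x - f y| < e.
    move=> p1 p2 p3; rewrite ltNge; apply/negP => p4; apply: hx.
    by exists x, y.
  move=> x y; rewrite !in_itv/= => /andP[p1 p2] /andP[p3 p4].
  case: (ltgtP x y) => [xy|xy|->]; first exact: hw.
    by rewrite distrC hw.
  by rewrite subrr normr0.
exists (s ++ [:: (x, y)]); split.
- apply: (@nonoverlapping_cat _ _ d') => //; last exact: ltW.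
    apply/andP; split; last by case/andP: hs.
    apply/allP => I Is; rewrite (allP h1)//=.
    by have /andP[/allP/(_ _ Is)/and3P[_ -> ->]] := hs.
  by apply: nonoverlapping1 => //; apply: ltW.
- exists x; first by rewrite ax (le_trans (ltW xy))// (le_trans (ltW yd)).
  rewrite all_cat/= lexx !andbT; apply/allP => I Is.
  by rewrite (le_trans _ (allP h1 _ Is))// ltW// (lt_trans xy).
- by rewrite all_cat h2/= /increment/= distrC he.
- by rewrite size_cat h3 addn1.
Qed.

(* Otherwise, short intervals accumulating at [a] can be appended again and
   again: their increments are so small that postponing them by [N] places
   costs at most a constant factor. *)
Lemma HBV_right_vanish a b f e : a < b -> HBV a b f -> 0 < e ->
  exists2 d, a < d <= b & forall s, nonoverlapping a d s ->
    all (fun I => a < I.1) s -> harmonic_sum f s <= e.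
Proof.
move=> ab hf e0; apply: contrapT => hn.
have [C C0 hC] := HBV_ub hf.
have hsh d N : a < d <= b -> exists s, [/\ nonoverlapping a d s,
    all (fun I => a < I.1) s &
    e / 4 <= \sum_(i < size s) `|increment f (nth (0, 0) s i)| / (N + i).+1%:R].
  move=> /andP[ad db].
  have [|d1 /andP[ad1 d1b] hd1] :=
      @HBV_right_cauchy _ _ _ (e / (2 * N.+1%:R)) ab hf.
    by rewrite divr_gt0// mulr_gt0.
  pose d2 := Num.min d ((a + d1) / 2).
  have ad2 : a < d2 by rewrite /d2 lt_min ad; lra.
  have d2d1 : d2 < d1 by rewrite /d2 gt_min; apply/orP; right; lra.
  have d2d : d2 <= d by rewrite /d2 ge_min lexx.
  have [s [hs ha hh]] : exists s, [/\ nonoverlapping a d2 s,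
      all (fun I => a < I.1) s & e < harmonic_sum f s].
    apply: contrapT => hx; apply: hn; exists d2.
      by rewrite ad2 (le_trans d2d).
    move=> s hs ha; rewrite leNgt; apply/negP => he; apply: hx.
    by exists s.
  exists s; split => //; first exact: nonoverlapping_sub hs.
  suff : harmonic_sum f s / 2 - e / 4 <=
      \sum_(i < size s) `|increment f (nth (0, 0) s i)| / (N + i).+1%:R by lra.
  have N10 : N.+1%:R != 0 :> R by rewrite pnatr_eq0.
  (* Postponed by [N] places, a term of index at least [N] keeps half of its weight. Each of the at
     most [N] earlier terms has an increment below 2 * c by the choice of [d1], so half of it is
     below [c]; together they cost at most e / 4. *)
  pose c := e / (4 * N.+1%:R).
  have c0 : 0 < c by rewrite divr_gt0// mulr_gt0.
  have hc : \sum_(i < size s) (if (i < N)%N then c else 0) <= e / 4.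
    have -> : \sum_(i < size s) (if (i < N)%N then c else 0) =
        c * (minn (size s) N)%:R.
      elim: (size s) => [|n IH]; first by rewrite big_ord0 min0n mulr0.
      rewrite big_ord_recr/= IH; case: ltnP => h.
        by rewrite !(minn_idPl _) ?(ltnW h)// -[n.+1]addn1 natrD mulrDr mulr1.
      by rewrite !(minn_idPr _) ?addr0// ltnW.
    have hN : (minn (size s) N)%:R <= N.+1%:R :> R
      by rewrite ler_nat (leq_trans (geq_minr _ _)).

    have -> : e / 4 = c * N.+1%:R by rewrite /c invfM mulrA mulfVK ?pnatr_eq0.
    by rewrite ler_wpM2l// ltW.
  have : harmonic_sum f s / 2 -
      \sum_(i < size s) (if (i < N)%N then c else 0) <=
      \sum_(i < size s) `|increment f (nth (0, 0) s i)| / (N + i).+1%:R.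
    rewrite /harmonic_sum mulr_suml -sumrB; apply: ler_sum => i _.
    set D := `|_|; have D0 : 0 <= D by rewrite /D.
    case: ltnP => iN; last first.
      rewrite subr0 -mulrA ler_wpM2l// -invfM lef_pV2 ?posrE ?mulr_gt0//.
      rewrite -natrM ler_nat.
      by rewrite muln2 -addnn -addnS leq_add2r leqW.
    have DC : D <= 2 * c.
      have -> : 2 * c = e / (2 * N.+1%:R) by rewrite /c; field; rewrite ?N10.
      have hi : nth (0, 0) s i \in s by rewrite mem_nth.
      have /andP[/allP/(_ _ hi)/and3P[h1 h2 h3] _] := hs.
      have h4 := allP ha _ hi.
      apply/ltW/hd1; rewrite in_itv/=.
        by rewrite (lt_trans h4 h2) (le_lt_trans h3).
      by rewrite h4 (lt_trans h2)// (le_lt_trans h3).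
    have D1 : D / i.+1%:R <= D by rewrite ler_piMr// invf_le1 ?ler1n.
    rewrite (@le_trans _ _ 0) ?divr_ge0// subr_le0 ler_pdivrMr//.
    by rewrite (le_trans D1)// mulrC.
  lra.
suff H n : exists2 s, nonoverlapping a b s &
    all (fun I => a < I.1) s /\ e / 4 * n%:R <= harmonic_sum f s.
  have [s hs [_ h]] := H (Num.bound (C / (e / 4))).
  have := hC _ hs; rewrite leNgt => /negP; apply; apply: lt_le_trans h.
  rewrite mulrC -ltr_pdivrMr ?divr_gt0//.
  by rewrite archi_boundP ?divr_ge0 ?ltW.
elim: n => [|n [s hs [ha IH]]].
  exists [::] => //; split => //.
  by rewrite /harmonic_sum big_ord0 mulr0.
have [d [ad db hd]] : exists d, [/\ a < d, d <= b & all (fun I => d <= I.1) s].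
  elim: s ha {hs IH} => [|I s IHs] /=; first by exists b; rewrite ab lexx.
  move=> /andP[aI /IHs[d [ad db hd]]]; exists (Num.min d I.1); split.
  - by rewrite lt_min ad.
  - by rewrite ge_min db.
  - rewrite ge_min lexx orbT/=; apply/allP => J /(allP hd) h.
    by rewrite ge_min h.
have [|s' [hs' ha' h']] := hsh d (size s); first by rewrite ad.
exists (s ++ s').
  apply: (@nonoverlapping_cat _ _ d) => //; last exact: ltW.
  apply/andP; split; last by case/andP: hs.
  apply/allP => I Is; rewrite (allP hd)//=.
  by have /andP[/allP/(_ _ Is)/and3P[_ -> ->]] := hs.
rewrite all_cat ha ha'; split => //.
by rewrite harmonic_sum_cat -(natr1 n) mulrDr mulr1 lerD.
Qed.

End HarmonicVariation.

(** * One-sided limits and increments over a uniform grid *)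

Section HarmonicVariationLimits.
Context {R : realType}.
Implicit Types (f g : R -> R) (a b d e : R).

Lemma V2_HBV a b f : V2 a b f -> HBV a b f.
Proof.
move=> [C hC]; have hq s : nonoverlapping a b s -> quadratic_sum f s <= C ^+ 2.
  move=> hs; have h : Num.sqrt (quadratic_sum f s) <= C by apply: hC; exists s.
  have q0 : 0 <= quadratic_sum f s by apply: sumr_ge0 => I _; rewrite exprn_ge0.
  rewrite -(sqr_sqrtr q0) lerXn2r ?nnegrE ?sqrtr_ge0//.
  exact: le_trans h.
exists (C ^+ 2 + 2) => _ [s /hq hs <-].
(* The induction needs the sharper bound 2 - 1 / (n + 1), which telescopes through 1 / (k + 1)^2 <=
   1 / k - 1 / (k + 1). *)
have h2 n : \sum_(i < n.+1) (i.+1%:R ^- 2 : R) <= 2 - n.+1%:R^-1.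
  elim: n => [|n IH]; first by rewrite big_ord1 expr1n invr1; lra.
  rewrite big_ord_recr/=; apply: (le_trans (lerD IH (lexx _))).
  have n0 : 0 <= n%:R :> R by [].
  rewrite -[n.+2%:R]natr1 -[n.+1%:R]natr1; set N := n%:R in n0 *.
  have h : (N + 1)^-1 - (N + 1 + 1)^-1 - (N + 1 + 1) ^- 2 =
      (N + 1)^-1 * (N + 1 + 1) ^- 2.
    by field; apply/andP; split; rewrite gt_eqF//; lra.
  have : 0 <= (N + 1)^-1 * (N + 1 + 1) ^- 2.
    by rewrite mulr_ge0// invr_ge0 ?exprn_ge0//; lra.
  by rewrite -h; lra.
have {}h2 n : \sum_(i < n) (i.+1%:R ^- 2 : R) <= 2.
  case: n => [|n]; first by rewrite big_ord0.
  by apply: (le_trans (h2 n)); rewrite gerBl invr_ge0.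
apply: (@le_trans _ _ (quadratic_sum f s + 2)); last by rewrite lerD2r.
apply: (@le_trans _ _ (\sum_(i < size s)
    (`|increment f (nth (0, 0) s i)| ^+ 2 + i.+1%:R ^- 2))).
  apply: ler_sum => i _; rewrite -exprVn.
  set u := `|_|; set v := (i.+1%:R^-1 : R); have : 0 <= (u - v) ^+ 2 by rewrite sqr_ge0.
  have : 0 <= u * v by apply: mulr_ge0; rewrite ?/u ?/v ?normr_ge0 ?invr_ge0 ?ler0n.
  by rewrite sqrrB -mulr_natr; lra.
rewrite big_split/= /quadratic_sum (big_nth (0, 0)) big_mkord lerD2l.
exact: h2.
Qed.

Lemma HBV_cvg_right a b f x : a <= x < b -> HBV a b f ->
  cvg (f y @[y --> x^'+]).
Proof.
move=> /andP[ax xb] hf.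
have {}hf : HBV x b f by apply: HBV_sub hf.
apply/cauchy_cvgP; apply: cauchy_exP => e e0.
have [d /andP[xd db] hd] := HBV_right_cauchy xb hf e0.
exists (f ((x + d) / 2)); rewrite /nbhs/=; near=> y.
apply: hd; rewrite in_itv/=; first by apply/andP; split; lra.
by apply/andP; split; near: y; [exact: nbhs_right_gt|exact: nbhs_right_lt].
Unshelve. all: by end_near. Qed.

Lemma HBV_opp a b f : HBV a b f -> HBV (- b) (- a) (f \o -%R).
Proof.
apply: HBV_antitone => [x y _ _|x]; first by rewrite ltrN2.
by rewrite !in_itv/= => /andP[? ?]; apply/andP; split; lra.
Qed.

Lemma HBV_cvg_left a b f x : a < x <= b -> HBV a b f ->
  cvg (f y @[y --> x^'-]).
Proof.
move=> /andP[ax xb] /HBV_opp hf.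
have h : cvg (f (- y) @[y --> (- x)^'+]).
  by apply: HBV_cvg_right hf; apply/andP; split; lra.
by apply/cvg_ex; exists (lim (f (- y) @[y --> (- x)^'+])); apply/cvg_at_leftNP.
Qed.

(** The number of increments of size at least e / 2 is bounded independently of [n], so their total
    is bounded and negligible against [n]; each of the others adds at most e / 2. *)
Lemma HBV_sum_increments a b f e : HBV a b f -> 0 < e ->
  \forall n \near \oo, forall s, nonoverlapping a b s -> (size s <= n)%N ->
    \sum_(I <- s) `|increment f I| <= e * n%:R.
Proof.
move=> hf e0; have [C C0 hC] := HBV_bounded hf.
have [|N hN] := @HBV_count _ _ _ _ (e / 2) hf; first by rewrite divr_gt0.
near=> n => s hs sn.
have hb I : I \in s -> `|increment f I| <= C.
  have /andP[/allP h _] := hs; move=> /h /and3P[h1 h2 h3].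
  by apply: hC; rewrite in_itv/= ?h3 ?h1 ?andbT/= ?(le_trans (ltW h2)) ?(le_trans h1 (ltW h2)).
apply: (@le_trans _ _ (\sum_(I <- s)
    (e / 2 + if e / 2 <= `|increment f I| then C else 0))).
  rewrite big_seq [leRHS]big_seq; apply: ler_sum => I Is.
  case: (leP (e / 2)) => h; last by rewrite addr0 ltW.
  by rewrite (le_trans (hb _ Is))// lerDr; lra.
rewrite big_split/= -big_mkcond/= !big_const_seq !iter_addr_0 count_predT.
have h1 : e / 2 *+ size s <= e / 2 * n%:R.
  by rewrite -mulr_natr ler_wpM2l ?ler_nat//; lra.
have h2 : C *+ count (fun I => e / 2 <= `|increment f I|) s <= e / 2 * n%:R.
  apply: (@le_trans _ _ (C * N%:R)); last first.
    rewrite -ler_pdivrMl ?divr_gt0//; near: n; exact: nbhs_infty_ger.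
  rewrite -(mulr_natr C) ler_wpM2l ?(ltW C0)// ler_nat -size_filter hN//.
    exact: nonoverlapping_filter.
  exact: filter_all.
by lra.
Unshelve. all: by end_near. Qed.

Definition grid a b (n i : nat) : R := a + (b - a) * i%:R / n%:R.

Lemma grid0 a b n : grid a b n 0 = a.
Proof. by rewrite /grid mulr0 mul0r addr0. Qed.

Lemma gridnn a b n : (0 < n)%N -> grid a b n n = b.
Proof. by move=> n0; rewrite /grid mulfK ?pnatr_eq0 -?lt0n// addrC subrK. Qed.

Lemma grid_le a b n i j : a < b -> (i <= j)%N -> grid a b n i <= grid a b n j.
Proof.
move=> ab ij; rewrite /grid lerD2l ler_wpM2r ?invr_ge0// ler_wpM2l ?ler_nat//.
by rewrite subr_ge0 ltW.
Qed.

Lemma grid_lt a b n i j : a < b -> (0 < n)%N -> (i < j)%N ->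
  grid a b n i < grid a b n j.
Proof.
move=> ab n0 ij; rewrite /grid ltrD2l ltr_pM2r ?invr_gt0 ?ltr0n//.
by rewrite ltr_pM2l ?ltr_nat// subr_gt0.
Qed.

Lemma nonoverlapping_grid a b a' b' n k m (s : nat -> R) : a < b ->
  a' <= grid a b n k -> grid a b n (k + m) <= b' ->
  (forall i, (k <= i < k + m)%N -> grid a b n i < s i <= grid a b n i.+1) ->
  nonoverlapping a' b' [seq (grid a b n i, s i) | i <- iota k m].
Proof.
move=> ab ha hb hs; apply/andP; split.
  rewrite all_map; apply/allP => i; rewrite mem_iota => /[dup] /andP[ki ikm].
  move=> /hs /andP[h1 h2] /=; rewrite h1 (le_trans ha (grid_le _ ab ki)).
  by rewrite (le_trans h2)// (le_trans _ hb)// grid_le.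
rewrite pairwise_map; apply: (@sub_in_pairwise _ (mem (iota k m)) ltn); last first.
- by rewrite -sorted_pairwise; [exact: iota_ltn_sorted|exact: ltn_trans].
- exact: allss.
move=> i j; rewrite !mem_iota => /hs /andP[_ h1] _ /= ij.
by rewrite (le_trans h1 (grid_le _ ab ij)).
Qed.

(** The sum is cut where the grid passes the [d] of [HBV_right_vanish]. Before the cut, the cells of
    index at least 1 give a harmonic sum over intervals that do not touch [a]; after it, the weights
    1 / i are O(1 / n) and [HBV_sum_increments] applies. The points [s] are left free because two
    choices occur later: right ends of cells and points of nearly maximal oscillation. *)
Lemma HBV_grid_sum a b f e : a < b -> HBV a b f -> 0 < e ->
  \forall n \near \oo, forall s : nat -> R,
    (forall i, (i < n)%N -> grid a b n i < s i <= grid a b n i.+1) ->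
    \sum_(1 <= i < n) `|f (s i) - f (grid a b n i)| / i%:R <= e.
Proof.
move=> ab hf e0.
have [|d /andP[ad db] hd] := @HBV_right_vanish _ _ _ _ (e / 2) ab hf.
  by rewrite divr_gt0.
have ba0 : 0 < b - a by rewrite subr_gt0.
have da0 : 0 < d - a by rewrite subr_gt0.
pose q := (d - a) / (b - a).
have q0 : 0 < q by rewrite divr_gt0.
have q1 : q <= 1 by rewrite ler_pdivrMr// mul1r lerD2r.
near=> n => s hs.
have n0 : (0 < n)%N by near: n; exact: nbhs_infty_gt.
have n0' : 0 < n%:R :> R by rewrite ltr0n.
pose m := maxn 1 (Num.trunc (q * n%:R)).
have /andP[m1 m2] := truncn_itv (ltW (mulr_gt0 q0 n0')).
have mn : (m <= n)%N.
  rewrite geq_max n0/= -(ler_nat R) (le_trans m1)//.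
  by rewrite ler_piMl// ltW.
rewrite (@big_cat_nat _ _ _ m)//=; last by rewrite leq_maxl.
have -> : e = e / 2 + e / 2 by lra.
apply: lerD.
  have [m_1|m_1] := leqP m 1.
    by rewrite big_geq// ltW// divr_gt0.
  have mE : m = Num.trunc (q * n%:R).
    by move: m_1; rewrite /m; case: (leqP (Num.trunc (q * n%:R)) 1).
  have hno : nonoverlapping a d
      [seq (grid a b n i, s i) | i <- iota 1 m.-1].
    apply: nonoverlapping_grid => //.
    - by rewrite -{1}(grid0 a b n) grid_le.
    - rewrite add1n prednK ?(ltnW m_1)// mE /grid -lerBrDl.
      rewrite ler_pdivrMr// mulrC -ler_pdivlMr// (le_trans m1)//.
      by rewrite /q; lra.
    - move=> i /andP[i1]; rewrite add1n prednK ?(ltnW m_1)// => im.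
      by apply: hs; apply: leq_trans mn.
  apply: le_trans (hd _ hno _); last first.
    rewrite all_map; apply/allP => i; rewrite mem_iota => /andP[i1 _] /=.
    by rewrite -{1}(grid0 a b n) grid_lt.
  rewrite /harmonic_sum size_map size_iota -{1}[m]prednK ?(ltnW m_1)//.
  rewrite big_add1 big_mkord/= le_eqVlt; apply/orP; left; apply/eqP.
  apply: eq_bigr => i _.
  by rewrite (nth_map 0%N) ?size_iota// nth_iota.
pose c := 2 / (q * n%:R).
have c0 : 0 < c by rewrite divr_gt0// mulr_gt0.
apply: (@le_trans _ _ (c * \sum_(I <- [seq (grid a b n i, s i) | i <- iota 0 n])
    `|increment f I|)).
  have -> : iota 0 n = index_iota 0 n by rewrite /index_iota subn0.
  rewrite big_map mulr_sumr.
  rewrite [leRHS](@big_cat_nat _ _ _ m)//= -[leLHS]add0r lerD//.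
    by apply: sumr_ge0 => i _; rewrite mulr_ge0// ltW.
  rewrite big_nat_cond [leRHS]big_nat_cond; apply: ler_sum => i /andP[/andP[mi _] _].
  rewrite mulrC ler_wpM2r// /c.
  have i1 : (0 < i)%N by apply: leq_trans mi; rewrite leq_max.
  have i0 : 0 < i%:R :> R by rewrite ltr0n.
  rewrite ler_pdivlMr ?(mulr_gt0 q0 n0')// ler_pdivrMl// -natrM.
  apply: (le_trans (ltW m2)); rewrite ler_nat.
  rewrite muln2 -addnn -addn1 leq_add//.
  by apply: leq_trans mi; rewrite leq_max leqnn orbT.
have hno : nonoverlapping a b [seq (grid a b n i, s i) | i <- iota 0 n].
  apply: nonoverlapping_grid => //; first by rewrite grid0.
  by rewrite add0n gridnn.
have hsz : (size [seq (grid a b n i, s i) | i <- iota 0 n] <= n)%N.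
  by rewrite size_map size_iota.
have H : \sum_(I <- [seq (grid a b n i, s i) | i <- iota 0 n])
    `|increment f I| <= e * q / 4 * n%:R.
  move: hno hsz; move: [seq _ | _ <- _]; near: n.
  by apply: HBV_sum_increments => //; rewrite divr_gt0// mulr_gt0.
apply: (le_trans (ler_wpM2l (ltW c0) H)).
rewrite /c le_eqVlt; apply/orP; left; apply/eqP; field.
by rewrite !gt_eqF.
Unshelve. all: by end_near. Qed.

End HarmonicVariationLimits.

(** * Kernels concentrating at one point *)

Section Localization.
Context {R : realType}.
Implicit Types (g k H Psi : R -> R) (a b : R).

(** Harmonic sums only see increments, whereas freezing [g] to [g c] on a cell costs its oscillation
    there. The supremum need not be attained, hence the factor 2. *)
Lemma half_oscillation a b g c d : HBV a b g -> a <= c -> c < d -> d <= b ->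
  exists2 s, c < s <= d & {in `]c, d[, forall x, `|g x - g c| <= 2 * `|g s - g c|}.
Proof.
move=> hg ac cd db; have [C C0 hC] := HBV_bounded hg.
pose E := [set `|g x - g c| | x in `]c, d[].
have mid : (c + d) / 2 \in `]c, d[ by rewrite in_itv/=; apply/andP; split; lra.
have hE : has_sup E.
  split; first by exists `|g ((c + d) / 2) - g c|, ((c + d) / 2).
  exists C => y [x /= xI <-]; move: xI; rewrite in_itv/= => /andP[cx xd].
  by apply: hC; rewrite in_itv/=; apply/andP; split; lra.
have Eub x : x \in `]c, d[ -> `|g x - g c| <= sup E.
  by move=> xI; apply: sup_upper_bound => //; exists x.
have [S0|S0] := leP (sup E) 0.
  exists ((c + d) / 2); first by apply/andP; split; lra.
  by move=> x xI; rewrite (le_trans (Eub _ xI))// (le_trans S0)// mulr_ge0.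
have [|y [s /= + sy] hs] := @sup_adherent _ E (sup E / 2) _ hE.
  by rewrite divr_gt0.
rewrite in_itv/= => /andP[cs sd]; rewrite -sy in hs.
exists s; first by rewrite cs ltW.
by move=> x xI; rewrite (le_trans (Eub _ xI))//; lra.
Qed.

(* [Psi] and [H] play the roles of primitives of [g * k] and [k]; this is the
   only property of integrals that the localization principle uses. *)
Definition primitive_pair a b g k H Psi := forall c d v M B,
  a <= c -> c < d -> d <= b ->
  {in `]c, d[, forall t, `|g t - v| <= M} ->
  {in `]c, d[, forall t, `|k t| <= B} ->
  `|Psi d - Psi c - v * (H d - H c)| <= M * B * (d - c).

Lemma summation_by_parts (u L : nat -> R) n : (0 < n)%N ->
  \sum_(1 <= i < n) u i * (L i - L i.+1) =
  u 1 * L 1 - u n * L n + \sum_(1 <= i < n) (u i.+1 - u i) * L i.+1.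
Proof.
elim: n => // -[|n] IH _; first by rewrite !big_geq// subrr addr0.
rewrite big_nat_recr//= IH// [in RHS]big_nat_recr//=; ring.
Qed.

(** One-sided form, with the concentration point at the left end [a]; the other side of an interior
    point is obtained from it by reflection. *)
Lemma localization_right a b g (l : R) (k H Psi : nat -> R -> R) (C : R) : a < b ->
  HBV a b g -> g x @[x --> a^'+] --> l ->
  (forall n, primitive_pair a b g (k n) (H n) (Psi n)) ->
  (forall n, (0 < n)%N -> {in `]a, b[, forall t, `|k n t| <= C * n%:R}) ->
  (forall n, (0 < n)%N -> {in `]a, b[, forall t, `|k n t| <= C / (t - a)}) ->
  (forall n, (0 < n)%N -> {in `]a, b[, forall t,
     `|H n b - H n t| <= C / (n%:R * (t - a))}) ->
  Psi n b - Psi n a - l * (H n b - H n a) @[n --> \oo] --> (0 : R).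
Proof.
move=> ab hg gl hP hk1 hk2 hH.
have ba0 : 0 < b - a by rewrite subr_gt0.
have C0 : 0 <= C.
  have := hk1 1%N isT ((a + b) / 2); rewrite in_itv/= => h.
  rewrite -[C]mulr1; apply: le_trans (h _) => //; apply/andP; split; lra.
(* [K1] and [K2] are the total factors, in the final estimate, of [e1] (distance from [g] to [l]
   near [a]) and of [e2] (harmonic sums over the grid). *)
have [K1 K1E] : exists K, K = C * (b - a) + C / (b - a) by eexists.
have [K2 K2E] : exists K, K = 2 * C + C / (b - a) by eexists.
have K10 : 0 <= K1 by rewrite K1E addr_ge0 ?divr_ge0 ?mulr_ge0 ?(ltW ba0).
have K20 : 0 <= K2 by rewrite K2E addr_ge0 ?divr_ge0 ?mulr_ge0 ?(ltW ba0).
apply/cvgr0Pnorm_le => e e0.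
pose e1 := e / (2 * (K1 + 1)); pose e2 := e / (2 * (K2 + 1)).
have e10 : 0 < e1 by rewrite divr_gt0// mulr_gt0//; lra.
have e20 : 0 < e2 by rewrite divr_gt0// mulr_gt0//; lra.
have [d d0 hd] : exists2 d, 0 < d & forall x, a < x < a + d -> `|g x - l| <= e1.
  move/cvgrPdist_le : gl => /(_ _ e10); rewrite near_withinE => -[d /= d0 hd].
  exists d => // x /andP[ax xd]; rewrite distrC; apply: hd => //=.
  by rewrite distrC ger0_norm ?subr_ge0 ?ltW//; lra.
near=> n.
have n0 : (0 < n)%N by near: n; exact: nbhs_infty_gt.
have n0' : 0 < n%:R :> R by rewrite ltr0n.
have Hgrid : forall s : nat -> R,
    (forall i, (i < n)%N -> grid a b n i < s i <= grid a b n i.+1) ->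
    \sum_(1 <= i < n) `|g (s i) - g (grid a b n i)| / i%:R <= e2.
  by near: n; apply: HBV_grid_sum.
pose t := grid a b n.
have tE i : t i - a = (b - a) * i%:R / n%:R by rewrite /t /grid addrC addKr.
have tS i : t i.+1 - t i = (b - a) / n%:R.
  have -> : t i.+1 - t i = (t i.+1 - a) - (t i - a) by ring.
  by rewrite !tE -mulrBl -mulrBr -natrB// subSnn mulr1.
have ta i : (0 < i)%N -> a < t i by move=> i0; rewrite -(grid0 a b n) grid_lt.
have tb i : (i <= n)%N -> t i <= b by move=> ?; rewrite -[leRHS](gridnn a b n0) grid_le.
have tt i : t i < t i.+1 by exact: grid_lt.
have a_le i : a <= t i by rewrite -[leLHS](grid0 a b n) grid_le.
have t1d : t 1 < a + d.
  rewrite -ltrBlDl tE mulr1 ltr_pdivrMr// -ltr_pdivrMl// mulrC; near: n.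
  exact: nbhs_infty_gtr.
have hg1 x : a < x -> x <= t 1 -> `|g x - l| <= e1.
  by move=> ax xt; apply: hd; rewrite ax (le_lt_trans xt).
pose P i s := (i < n)%N -> t i < s <= t i.+1 /\
  {in `]t i, t i.+1[, forall x, `|g x - g (t i)| <= 2 * `|g s - g (t i)|}.
have [s hs] : {s : nat -> R & forall i, P i (s i)}.
  apply: choice => i; have [i_n|ni] := ltnP i n; last first.
    by exists 0; rewrite /P ltnNge ni.
  have [s h1 h2] := half_oscillation hg (a_le i) (tt i) (tb _ i_n).
  by exists s.
have Hs1 : \sum_(1 <= i < n) `|g (s i) - g (t i)| / i%:R <= e2.
  by apply: Hgrid => i /hs[].
have Hs2 : \sum_(1 <= i < n) `|g (t i.+1) - g (t i)| / i%:R <= e2.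
  by apply: (Hgrid (fun i => t i.+1)) => i _; rewrite lexx andbT; apply: tt.
pose L i := H n b - H n (t i).
have Ln : L n = 0 by rewrite /L /t gridnn// subrr.
have Lb i : (0 < i <= n)%N -> `|L i| <= C / (b - a) / i%:R.
  move=> /andP[i0]; rewrite leq_eqVlt => /predU1P[->|i_n].
    by rewrite Ln normr0 !divr_ge0// ltW.
  have := hH n n0 (t i); rewrite in_itv/= ta// -[X in t i < X](gridnn a b n0).
  rewrite grid_lt// => /(_ isT) h; apply: (le_trans h).
  rewrite tE le_eqVlt; apply/orP; left; apply/eqP; field.
  by rewrite !gt_eqF// ltr0n.
have tel (F : R -> R) : F b - F a = \sum_(0 <= i < n) (F (t i.+1) - F (t i)).
  rewrite (telescope_sumr (fun i => F (t i)))//.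
  by rewrite /t gridnn// grid0.
have dL i : H n (t i.+1) - H n (t i) = L i - L i.+1 by rewrite /L; ring.
(* Three errors: on the first cell [g] is close to [l]; on the others [g] is frozen at the left grid
   point; the last sum is treated by parts, where [L i] = O(1 / i) puts the harmonic weights on the
   increments of [g] between grid points. *)
have -> : Psi n b - Psi n a - l * (H n b - H n a) =
   (Psi n (t 1) - Psi n (t 0) - l * (H n (t 1) - H n (t 0))) +
   (\sum_(1 <= i < n) (Psi n (t i.+1) - Psi n (t i) -
       g (t i) * (H n (t i.+1) - H n (t i))) +
    \sum_(1 <= i < n) (g (t i) - l) * (L i - L i.+1)).
  rewrite !tel mulr_sumr -sumrB big_ltn//; congr (_ + _).
  rewrite -big_split/=; apply: eq_bigr => i _.
  by rewrite -dL; ring.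
have B0 : `|Psi n (t 1) - Psi n (t 0) - l * (H n (t 1) - H n (t 0))| <=
    e1 * (C * (b - a)).
  have := hP n (t 0) (t 1) l e1 (C * n%:R) (a_le _) (tt _) (tb _ n0).
  rewrite tS => h; apply: (le_trans (h _ _)).
  - move=> x; rewrite in_itv/= => /andP[x1 x2]; apply: hg1 (ltW x2).
    by rewrite (le_lt_trans _ x1).
  - move=> x; rewrite in_itv/= => /andP[x1 x2]; apply: hk1 => //.
    by rewrite in_itv/= (le_lt_trans _ x1)//= (lt_le_trans x2)// tb.
  - rewrite le_eqVlt; apply/orP; left; apply/eqP; field.
    by rewrite gt_eqF.
have B1 : `|\sum_(1 <= i < n) (Psi n (t i.+1) - Psi n (t i) -
       g (t i) * (H n (t i.+1) - H n (t i)))| <= 2 * C * e2.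
  apply: (le_trans (ler_norm_sum _ _ _)).
  apply: le_trans (ler_wpM2l _ Hs1); last by rewrite mulr_ge0.
  rewrite mulr_sumr big_nat_cond [leRHS]big_nat_cond.
  apply: ler_sum => i /andP[/andP[i0 i_n] _].
  have i0' : 0 < i%:R :> R by rewrite ltr0n.
  have [_ hsi] := hs _ i_n.
  have := hP n (t i) (t i.+1) (g (t i)) (2 * `|g (s i) - g (t i)|)
    (C / (t i - a)) (a_le _) (tt _) (tb _ i_n).
  rewrite tS => h; apply: (le_trans (h hsi _)).
    move=> x; rewrite in_itv/= => /andP[x1 x2].
    have ax : a < x by rewrite (lt_trans _ x1)// ta.
    apply: (@le_trans _ _ (C / (x - a))).
      by apply: hk2 => //; rewrite in_itv/= ax/= (lt_le_trans x2)// tb.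
    rewrite ler_wpM2l// lef_pV2 ?posrE ?subr_gt0 ?ta//.
    by rewrite lerD2r ltW.
  rewrite tE le_eqVlt; apply/orP; left; apply/eqP; field.
  by rewrite !gt_eqF.
have B2 : `|\sum_(1 <= i < n) (g (t i) - l) * (L i - L i.+1)| <=
    e1 * (C / (b - a)) + C / (b - a) * e2.
  rewrite (summation_by_parts (fun i => g (t i) - l)) //= Ln mulr0 subr0.
  apply: (le_trans (ler_normD _ _)); apply: lerD.
    rewrite normrM ler_pM// ?hg1 ?ta//.
    by apply: (le_trans (Lb _ _)) => //; rewrite divr1.
  apply: (le_trans (ler_norm_sum _ _ _)).
  apply: le_trans (ler_wpM2l _ Hs2); last by rewrite divr_ge0// ltW.
  rewrite mulr_sumr big_nat_cond [leRHS]big_nat_cond.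
  apply: ler_sum => i /andP[/andP[i0 i_n] _].
  have i0' : 0 < i%:R :> R by rewrite ltr0n.
  have -> : g (t i.+1) - l - (g (t i) - l) = g (t i.+1) - g (t i) by ring.
  rewrite normrM mulrCA ler_wpM2l//.
  apply: (le_trans (Lb _ _)) => //.
  rewrite ler_wpM2l ?divr_ge0 ?(ltW ba0)// lef_pV2 ?posrE ?ltr0n//.
  by rewrite ler_nat.
apply: (le_trans (ler_normD _ _)); apply: (le_trans (lerD B0 (ler_normD _ _))).
apply: (le_trans (lerD (lexx _) (lerD B1 B2))).
have -> : e1 * (C * (b - a)) + (2 * C * e2 + (e1 * (C / (b - a)) +
    C / (b - a) * e2)) = e1 * K1 + e2 * K2 by rewrite K1E K2E; ring.
have h1 : e1 * K1 <= e / 2.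
  rewrite /e1 invfM mulrA -mulrA ler_piMr//; first by rewrite divr_ge0// ltW.
  by rewrite mulrC ler_pdivrMr ?mul1r; lra.
have h2 : e2 * K2 <= e / 2.
  rewrite /e2 invfM mulrA -mulrA ler_piMr//; first by rewrite divr_ge0// ltW.
  by rewrite mulrC ler_pdivrMr ?mul1r; lra.
by lra.
Unshelve. all: by end_near. Qed.

End Localization.

(** * Bounds for trigonometric sums *)

Section TrigonometricSums.
Context {R : realType}.
Implicit Types t x : R.

Lemma sin_cos_prod x y : 2 * (sin x * cos y) = sin (x + y) + sin (x - y) :> R.
Proof. by rewrite sinD sinB; ring. Qed.

Lemma sin_sin_prod x y : 2 * (sin x * sin y) = cos (x - y) - cos (x + y) :> R.
Proof. by rewrite cosB cosD; ring. Qed.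

Lemma cos_cos_prod x y : 2 * (cos x * cos y) = cos (x - y) + cos (x + y) :> R.
Proof. by rewrite cosB cosD; ring. Qed.

Lemma sum_cosE n t : 2 * sin (t / 2) * \sum_(i < n) cos (i.+1%:R * t) =
  sin ((n%:R + 2^-1) * t) - sin (t / 2).
Proof.
elim: n => [|n IH].
  by rewrite big_ord0 mulr0 add0r mulrC subrr.
rewrite big_ord_recr/= mulrDr IH -mulrA sin_cos_prod -(natr1 n).
have -> : t / 2 - (n%:R + 1) * t = - ((n%:R + 2^-1) * t) by field.
have -> : t / 2 + (n%:R + 1) * t = (n%:R + 1 + 2^-1) * t by field.
by rewrite sinN; ring.
Qed.

Lemma sum_sinE n t : 2 * sin (t / 2) * \sum_(i < n) sin (i.+1%:R * t) =
  cos (t / 2) - cos ((n%:R + 2^-1) * t).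
Proof.
elim: n => [|n IH].
  by rewrite big_ord0 mulr0 add0r mulrC subrr.
rewrite big_ord_recr/= mulrDr IH -mulrA sin_sin_prod -(natr1 n).
have -> : t / 2 - (n%:R + 1) * t = - ((n%:R + 2^-1) * t) by field.
have -> : t / 2 + (n%:R + 1) * t = (n%:R + 1 + 2^-1) * t by field.
by rewrite cosN; ring.
Qed.

Lemma ler_sum_cos n t :
  `|\sum_(i < n) cos (i.+1%:R * t)| * `|sin (t / 2)| <= 1.
Proof.
rewrite -normrM mulrC -(@ler_pM2l _ 2)// mulr1 -[X in X * `|_|]ger0_norm//.
rewrite -normrM mulrA sum_cosE (le_trans (ler_normB _ _))//.
by have := sin_max ((n%:R + 2^-1) * t); have := sin_max (t / 2); lra.
Qed.

Lemma ler_sum_sin n t :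
  `|\sum_(i < n) sin (i.+1%:R * t)| * `|sin (t / 2)| <= 1.
Proof.
rewrite -normrM mulrC -(@ler_pM2l _ 2)// mulr1 -[X in X * `|_|]ger0_norm//.
rewrite -normrM mulrA sum_sinE (le_trans (ler_normB _ _))//.
by have := cos_max ((n%:R + 2^-1) * t); have := cos_max (t / 2); lra.
Qed.

(** Abel summation leaves [n] times the full sum of sines minus the [n] shorter sums, and each of
    these is controlled by [ler_sum_sin]; hence n + n. *)
Lemma ler_sum_weighted_sin n t :
  `|\sum_(i < n) i.+1%:R * sin (i.+1%:R * t)| * `|sin (t / 2)| <= 2 * n%:R.
Proof.
pose A m := \sum_(i < m) sin (i.+1%:R * t).
have -> : \sum_(i < n) i.+1%:R * sin (i.+1%:R * t) =
    n%:R * A n - \sum_(i < n) A i.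
  elim: n => [|n IH]; first by rewrite !big_ord0 mul0r subrr.
  rewrite big_ord_recr/= IH [in RHS]big_ord_recr/=.
  have -> : A n.+1 = A n + sin (n.+1%:R * t) by rewrite /A big_ord_recr.
  by rewrite -(natr1 n); ring.
apply: le_trans (ler_wpM2r (normr_ge0 _) (ler_normB _ _)) _.
have -> : 2 * n%:R = n%:R + n%:R :> R by ring.
rewrite mulrDl; apply: lerD.
  by rewrite normrM normr_nat -mulrA ler_piMr// ler_sum_sin.
apply: (le_trans (ler_wpM2r (normr_ge0 _) (ler_norm_sum _ _ _))).
have -> : n%:R = \sum_(i < n) (1 : R) by rewrite sumr_const card_ord.
rewrite mulr_suml.
by apply: ler_sum => i _; apply: ler_sum_sin.
Qed.

(** A primitive of the Dirichlet kernel 1 / 2 + sum_k cos (k t). As sum_k sin (k t) / k is the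
    Fourier series of (pi - t) / 2 on (0, 2 pi), the added t / 2 makes the limit there the constant
    pi / 2. *)
Definition sawtooth_sum n t : R := t / 2 + \sum_(i < n) sin (i.+1%:R * t) / i.+1%:R.

Lemma is_derive_sawtooth_sum n t :
  is_derive t 1 (sawtooth_sum n) (2^-1 + \sum_(i < n) cos (i.+1%:R * t)).
Proof.
rewrite /sawtooth_sum.
have -> : (fun t => t / 2 + \sum_(i < n) sin (i.+1%:R * t) / i.+1%:R) =
    (fun t => t / 2) + \sum_(i < n) (fun t => sin (i.+1%:R * t) / i.+1%:R) :> (R -> R).
  by apply/funext => u; rewrite fctE/= fct_sumE.
apply: is_deriveD.
  by apply: is_derive_eq; rewrite !scaler0 add0r /GRing.scale/= mulr1.
apply: (@is_derive_sum R R R n (fun i t => sin (i.+1%:R * t) / i.+1%:R) t 1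
  (fun i => cos (i.+1%:R * t))) => i; apply: is_derive_eq.
rewrite !scaler0 add0r /GRing.scale/= mulr1 mulrC mulfK//.
Qed.

Lemma sawtooth_sumN n t : sawtooth_sum n (- t) = - sawtooth_sum n t.
Proof.
rewrite /sawtooth_sum mulNr opprD -sumrN; congr (_ + _).
by apply: eq_bigr => i _; rewrite mulrN sinN mulNr.
Qed.

Lemma sin_natpi n : sin (n%:R * pi) = 0 :> R.
Proof.
elim: n => [|n IH]; first by rewrite mul0r sin0.
by rewrite -natr1 mulrDl mul1r sinD IH sinpi mul0r mulr0 addr0.
Qed.

Lemma sawtooth_sumpi n : sawtooth_sum n pi = pi / 2.
Proof.
rewrite /sawtooth_sum big1 ?addr0// => i _.
by rewrite sin_natpi mul0r.
Qed.

Lemma sin_half_gt0 t : 0 < t < 2 * pi -> 0 < sin (t / 2).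
Proof. by move=> /andP[t0 t2]; apply: sin_gt0_pi; apply/andP; split; lra. Qed.

(* With [w t = 1 / (2 sin (t/2))], the derivative of [sawtooth_sum n] is
   [sin (N t) w t] where [N = n + 1/2]; adding [(cos (N t) + e) w t / N] with
   [e = 1] or [e = -1] leaves a derivative of constant sign on either side
   of [pi]. *)
Lemma sawtooth_sum_bound n t : (0 < n)%N -> 0 < t < 2 * pi ->
  `|sawtooth_sum n t - pi / 2| <= (n%:R * sin (t / 2))^-1.
Proof.
move=> n0 t0; have n0' : 0 < n%:R :> R by rewrite ltr0n.
have [N NE] : exists N : R, N = n%:R + 2^-1 by eexists.
have N0 : 0 < N by rewrite NE; lra.
pose w (s : R) := (2 * sin (s / 2))^-1.
have w0 s : 0 < s < 2 * pi -> 0 < w s.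
  by move=> /sin_half_gt0 h; rewrite invr_gt0 mulr_gt0.
pose G e s := sawtooth_sum n s + (cos (N * s) + e) * w s / N.
pose dG e s := (cos (N * s) + e) * (- (cos (s / 2) / (2 * sin (s / 2)) ^+ 2)) / N.
have hG e s : 0 < s < 2 * pi -> is_derive s 1 (G e) (dG e s).
  move=> hs; have /lt0r_neq0 s0 := sin_half_gt0 hs.
  have hF := is_derive_sawtooth_sum n s.
  have h2 : 2 * sin (s / 2) != 0 by rewrite mulf_neq0.
  rewrite /G /w.
  have hw : is_derive s 1 (fun s : R => (2 * sin (s / 2))^-1)
      (- (2 * sin (s / 2)) ^- 2 *: cos (s / 2)).
    apply: is_deriveV => //; apply: is_derive_eq.
    by rewrite ?scaler0 ?addr0 ?add0r /GRing.scale/=; field.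
  apply: is_derive_eq.
  have hS : 2^-1 + \sum_(i < n) cos (i.+1%:R * s) = sin (N * s) / (2 * sin (s / 2)).
    apply: (mulfI h2); rewrite mulrDr sum_cosE -NE; field.
    by rewrite s0.
  rewrite hS /dG ?scaler0 ?addr0 /GRing.scale/=; field.
  by rewrite s0 gt_eqF.
(* The sign of [dG] is governed by [cos (s / 2)], which changes at pi exactly as pi - s does. Hence
   the comparison with the point pi, where moreover [sawtooth_sum] equals pi / 2. *)
have cos_half (c : R) : 0 <= c <= 2 * pi -> 0 <= (pi - c) * cos (c / 2).
  move=> /andP[c0 c2]; have pi0 := pi_gt0 R.
  have [cpi|picc] := leP c pi.
    rewrite mulr_ge0 ?subr_ge0//; apply: cos_ge0_pihalf.
    by apply/andP; split; lra.
  rewrite -mulrNN mulr_ge0//; first by rewrite oppr_ge0 subr_le0 ltW.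
  rewrite oppr_ge0; apply: (@le_trans _ _ (cos (pi / 2))); last by rewrite cos_pihalf.
  rewrite leNgt ltr_cos -?leNgt ?in_itv/=.
  - by lra.
  - by apply/andP; split; lra.
  - by apply/andP; split; lra.
have pi0 := pi_gt0 R.
have mvt (e : R) : exists c, [/\ 0 < c < 2 * pi, G e t - G e pi = dG e c * (t - pi)
    & 0 <= (pi - t) * cos (c / 2)].
  have dwc u v : 0 < u -> v < 2 * pi -> {within `[u, v], continuous (G e)}.
    move=> u0 v2; apply: derivable_within_continuous => x.
    rewrite in_itv/= => /andP[x1 x2].
    have xx : 0 < x < 2 * pi by rewrite (lt_le_trans u0 x1) (le_lt_trans x2 v2).
    by have [] := hG e x xx.
  have pi2 : pi < 2 * pi :> R by lra.
  move: t0 => /andP[t0 t2].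
  case: (ltgtP t pi) => [tpi|tpi|->]; last first.
  - exists pi; rewrite !subrr mulr0 mul0r lexx; split=> //.
    by rewrite pi0/=; lra.
  - have [x|c] := @MVT R (G e) (dG e) pi t tpi _ (dwc _ _ pi0 t2).
      rewrite in_itv/= => /andP[x1 x2]; apply: hG.
      by rewrite (lt_trans pi0 x1) (lt_trans x2 t2).
    rewrite in_itv/= => /andP[c1 c2] hc; exists c; split => //.
      by rewrite (lt_trans pi0 c1) (lt_trans c2 t2).
    have := cos_half c; rewrite (ltW (lt_trans pi0 c1)) (ltW (lt_trans c2 t2)).
    move=> /(_ isT) h; rewrite -mulrNN mulr_ge0//; first by lra.
    have cpi : 0 < c - pi by lra.
    by move: h; rewrite -mulrNN opprB pmulr_rge0.
  - have [x|c] := @MVT R (G e) (dG e) t pi tpi _ (dwc _ _ t0 pi2).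
      rewrite in_itv/= => /andP[x1 x2]; apply: hG.
      by rewrite (lt_trans t0 x1) (lt_trans x2).
    rewrite in_itv/= => /andP[c1 c2] hc; exists c; split => //.
    - by rewrite (lt_trans t0 c1)/= (lt_trans c2).
    - by rewrite -[LHS]opprB hc; ring.
    have := cos_half c; rewrite (ltW (lt_trans t0 c1)) (ltW (lt_trans c2 pi2)).
    move=> /(_ isT) h; rewrite mulr_ge0//; first by lra.
    have cpi : 0 < pi - c by lra.
    by move: h; rewrite pmulr_rge0.
have key (e : R) : exists2 r, 0 <= r & exists c, G e t - G e pi = (cos c + e) * r.
  have [c [hc -> hs]] := mvt e.
  exists ((pi - t) * cos (c / 2) / (2 * sin (c / 2)) ^+ 2 / N).
    by rewrite !divr_ge0// ?sqr_ge0// ltW.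
  by exists (N * c); rewrite /dG; ring.
have Gpi (e : R) : G e pi = pi / 2 + (cos (N * pi) + e) * (2^-1 / N).
  by rewrite /G sawtooth_sumpi /w sin_pihalf mulr1 mulrA.
have W0 : 0 <= w t / N by rewrite divr_ge0 ?ltW// w0.
have N1 : 0 <= 2^-1 / N by rewrite divr_ge0// ltW.
have WE : 2 * (w t / N) = (N * sin (t / 2))^-1.
  have := sin_half_gt0 t0 => /lt0r_neq0 s0.
  by rewrite /w; field; rewrite s0 gt_eqF.
apply: (@le_trans _ _ (2 * (w t / N))); last first.
  rewrite WE lef_pV2 ?posrE ?mulr_gt0 ?sin_half_gt0//.
  by rewrite ler_wpM2r ?(ltW (sin_half_gt0 t0))// NE; lra.
(* [e] = 1 puts [G] at [t] above its value at pi and yields the lower bound, [e] = -1 the upper one.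
   The correction at pi has the favourable sign in both cases, and the one at [t] is at most 2 *
   W. *)
have [r1 r10 [c1]] := key 1; have [r2 r20 [c2]] := key (-1).
rewrite !Gpi /G -!(mulrA _ (w t)).
set W := w t / N in W0 *; set V := 2^-1 / N in N1 *.
set S := sawtooth_sum n t => h2 h1.
have a1 : 0 <= (cos c1 + 1) * r1 by rewrite mulr_ge0//; have := cos_geN1 c1; lra.
have a2 : 0 <= (1 - cos c2) * r2 by rewrite mulr_ge0//; have := cos_le1 c2; lra.
have a3 : 0 <= (cos (N * pi) + 1) * V.
  by rewrite mulr_ge0//; have := cos_geN1 (N * pi); lra.
have a4 : 0 <= (1 - cos (N * pi)) * V.
  by rewrite mulr_ge0//; have := cos_le1 (N * pi); lra.
have a5 : 0 <= (cos (N * t) + 1) * W.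
  by rewrite mulr_ge0//; have := cos_geN1 (N * t); lra.
have a6 : 0 <= (1 - cos (N * t)) * W.
  by rewrite mulr_ge0//; have := cos_le1 (N * t); lra.
by rewrite ler_norml; apply/andP; split; lra.
Qed.

End TrigonometricSums.

Lemma cvg_eq_fun (R : realType) (f g : nat -> R) (l : R) : f =1 g ->
  f n @[n --> \oo] --> l -> g n @[n --> \oo] --> l.
Proof. by move=> /funext ->. Qed.

Lemma cvgn_add (R : realType) (f g : nat -> R) (l m : R) :
  f n @[n --> \oo] --> l -> g n @[n --> \oo] --> m ->
  f n + g n @[n --> \oo] --> l + m.
Proof. by move=> hf hg; apply: cvgD. Qed.

(** * The Dirichlet kernel and the jump kernel *)

Section Kernels.
Context {R : realType}.
Implicit Types (th phi : R) (g : R -> R) (k H Psi : nat -> R -> R).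

(** As |phi - th| / 2 <= M / 2 < pi / 2, the mean value theorem gives the first bound with slope cos
    (M / 2). For the second, phi + th stays away from 0 and 2 * pi, so the sine is even bounded
    below by [m]; the weaker form lets the parts of a kernel in phi - th and in phi + th be
    estimated alike. *)
Lemma half_angle_bound th : 0 < th < pi -> exists2 c : R, 0 < c &
  {in `[0, pi], forall phi, c * `|phi - th| <= `|sin ((phi - th) / 2)| /\
    c * `|phi - th| <= sin ((phi + th) / 2)}.
Proof.
move=> /andP[th0 thpi]; have pi0 := pi_gt0 R.
pose M := Num.max th (pi - th).
have thM : th <= M by rewrite le_max lexx.
have thM' : pi - th <= M by rewrite le_max lexx orbT.
have Mpi : M < pi by rewrite gt_max thpi; lra.
pose m := Num.min (sin (th / 2)) (cos (th / 2)).
have m0 : 0 < m.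
  rewrite lt_min sin_gt0_pi ?cos_gt0_pihalf//; apply/andP; split; lra.
have c10 : 0 < cos (M / 2) / 2.
  by rewrite divr_gt0// cos_gt0_pihalf//; apply/andP; split; lra.
exists (Num.min (cos (M / 2) / 2) (m / pi)).
  by rewrite lt_min c10 divr_gt0.
move=> phi; rewrite in_itv/= => /andP[phi0 phipi].
have hphi : `|phi - th| <= M by rewrite ler_norml; apply/andP; split; lra.
have hphi' : `|phi - th| <= pi by rewrite (le_trans hphi)// ltW.
split.
  apply: (@le_trans _ _ (cos (M / 2) / 2 * `|phi - th|)).
    by rewrite ler_wpM2r// ge_min lexx.
  have -> : `|sin ((phi - th) / 2)| = sin (`|phi - th| / 2).
    have [h|h] := leP 0 (phi - th).
      rewrite [`|phi - th|]ger0_norm// ger0_norm// sin_ge0_pi//.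
      by apply/andP; split; lra.
    rewrite [`|phi - th|]ltr0_norm// mulNr sinN ler0_norm//.
    rewrite -oppr_ge0 -sinN -mulNr sin_ge0_pi//.
    by apply/andP; split; lra.
  set u := `|phi - th| in hphi hphi' *; have u0 : 0 <= u by rewrite /u.
  have [||x] := @MVT_segment R sin cos 0 (u / 2); first by lra.
  - by apply: continuous_subspaceT => x; apply: continuous_sin.
  rewrite in_itv/= => /andP[x0 xu]; rewrite sin0 !subr0 => ->.
  rewrite mulrAC -mulrA ler_wpM2r//; first by lra.
  rewrite leNgt ltr_cos ?in_itv/= -?leNgt; first by lra.
  - by apply/andP; split; lra.
  - by apply/andP; split; lra.
apply: (@le_trans _ _ m).
  rewrite -[leRHS](@divfK _ pi) ?gt_eqF// ler_pM//.
  - by rewrite le_min !ltW// divr_gt0.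
  - by rewrite ge_min lexx orbT.
have -> : (phi + th) / 2 = phi / 2 + th / 2 by lra.
rewrite sinD.
have s0 : 0 <= sin (phi / 2) by apply: sin_ge0_pi; apply/andP; split; lra.
have c0 : 0 <= cos (phi / 2) by apply: cos_ge0_pihalf; apply/andP; split; lra.
have h1 : m * sin (phi / 2) <= sin (phi / 2) * cos (th / 2).
  by rewrite mulrC ler_wpM2l// ge_min lexx orbT.
have h2 : m * cos (phi / 2) <= cos (phi / 2) * sin (th / 2).
  by rewrite mulrC ler_wpM2l// ge_min lexx.
have h3 : 1 <= sin (phi / 2) + cos (phi / 2).
  rewrite -[leLHS](@cos2Dsin2 R (phi / 2)).
  have a1 : 0 <= sin (phi / 2) * (1 - sin (phi / 2)).
    by rewrite mulr_ge0// subr_ge0 sin_le1.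
  have a2 : 0 <= cos (phi / 2) * (1 - cos (phi / 2)).
    by rewrite mulr_ge0// subr_ge0 cos_le1.
  by rewrite !expr2; lra.
have h4 : m * 1 <= m * (sin (phi / 2) + cos (phi / 2)) by rewrite ler_wpM2l// ltW.
by lra.
Qed.

(* [k n] concentrates at [th]: [H n] stands for a primitive of [k n] on
   [0, pi], and the last two bounds express that [k n] oscillates at
   frequency [n]. *)
Definition localized_kernel th k H := exists C : R, forall n phi, (0 < n)%N ->
  0 <= phi <= pi -> phi != th ->
  [/\ `|k n phi| <= C * n%:R, `|k n phi| <= C / `|phi - th|,
      th < phi -> `|H n pi - H n phi| <= C / (n%:R * `|phi - th|) &
      phi < th -> `|H n phi - H n 0| <= C / (n%:R * `|phi - th|)].

Lemma localization th g k H Psi (lp lm : R) : 0 < th < pi ->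
  HBV 0 pi g -> localized_kernel th k H ->
  (forall n, primitive_pair 0 pi g (k n) (H n) (Psi n)) ->
  g x @[x --> th^'+] --> lp -> g x @[x --> th^'-] --> lm ->
  Psi n pi - Psi n 0 -
    (lp * (H n pi - H n th) + lm * (H n th - H n 0)) @[n --> \oo] --> (0 : R).
Proof.
move=> /andP[th0 thpi] hg [C hC] hP hp hm; have pi0 := pi_gt0 R.
have right : Psi n pi - Psi n th - lp * (H n pi - H n th) @[n --> \oo] --> (0 : R).
  have hr n t : (0 < n)%N -> t \in `]th, pi[ ->
      [/\ `|k n t| <= C * n%:R, `|k n t| <= C / (t - th) &
          `|H n pi - H n t| <= C / (n%:R * (t - th))].
    move=> n0; rewrite in_itv/= => /andP[t1 t2].
    have t0pi : 0 <= t <= pi by apply/andP; split; lra.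
    have [] := hC n t n0 t0pi; first by rewrite gt_eqF.
    by rewrite [`|t - th|]gtr0_norm ?subr_gt0// => h1 h2 /(_ t1) h3 _.
  apply: (localization_right (k := k) (C := C) thpi _ hp).
  - by apply: HBV_sub hg => //; apply: ltW.
  - move=> n c d v M B h1 h2 h3; apply: hP => //.
    by apply: le_trans h1; apply: ltW.
  - by move=> n n0 t /(hr n t n0)[].
  - by move=> n n0 t /(hr n t n0)[].
  - by move=> n n0 t /(hr n t n0)[].
(* Reflection in 0 carries the left side of [th] to the right side of [- th]; primitives change sign
   under it, kernels do not. *)
have left : - Psi n (- 0) - - Psi n (- - th) - lm * (- H n (- 0) - - H n (- - th))
    @[n --> \oo] --> (0 : R).
  have hl n t : (0 < n)%N -> t \in `](- th), 0[ ->
      [/\ `|k n (- t)| <= C * n%:R, `|k n (- t)| <= C / (t - - th) &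
          `|H n (- t) - H n 0| <= C / (n%:R * (t - - th))].
    move=> n0; rewrite in_itv/= => /andP[t1 t2].
    have t0pi : 0 <= - t <= pi by apply/andP; split; lra.
    have tth : - t < th by lra.
    have [] := hC n (- t) n0 t0pi; first by rewrite lt_eqF.
    rewrite [`|- t - th|]ltr0_norm ?subr_lt0// => h1 h2 _ /(_ tth) h3.
    by have -> : t - - th = - (- t - th) by ring.
  apply: (@localization_right R (- th) 0 (g \o -%R) lm (fun n t => k n (- t))
    (fun n t => - H n (- t)) (fun n t => - Psi n (- t)) C).
  - by rewrite oppr_lt0.
  - by have /HBV_opp := HBV_sub (lexx 0) (ltW thpi) hg; rewrite oppr0.
  - exact/cvg_at_leftNP.
  - move=> n c d v M B h1 h2 h3 h4 h5.
    have := hP n (- d) (- c) v M B; rewrite oppr_ge0 => /(_ h3).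
    rewrite ltrN2 => /(_ h2); have -> : - c <= pi by lra.
    move=> /(_ isT) h; have -> : - Psi n (- d) - - Psi n (- c) -
        v * (- H n (- d) - - H n (- c)) =
      Psi n (- c) - Psi n (- d) - v * (H n (- c) - H n (- d)) by ring.
    have -> : d - c = - c - - d by ring.
    apply: h => t; rewrite in_itv/= => /andP[t1 t2].
    + rewrite -[t]opprK; apply: (h4 (- t)).
      by rewrite in_itv/=; apply/andP; split; lra.
    + rewrite -[t]opprK; apply: (h5 (- t)).
      by rewrite in_itv/=; apply/andP; split; lra.
  - by move=> n n0 t /(hl n t n0)[].
  - by move=> n n0 t /(hl n t n0)[].
  - move=> n n0 t /(hl n t n0)[_ _].
    by have -> : - H n (- 0) - - H n (- t) = H n (- t) - H n 0 by rewrite oppr0; ring.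
rewrite -[X in _ --> X](addr0 0); apply: cvg_eq_fun (cvgn_add right left) => n.
by rewrite /= oppr0 !opprK; ring.
Qed.

(** Up to the factor 1 / pi, the kernel of the partial sums at [th] of the cosine series; its
    integral over [0, pi] is pi. *)
Definition dirichlet_kernel th n phi : R :=
  1 + 2 * \sum_(i < n) cos (i.+1%:R * th) * cos (i.+1%:R * phi).

Definition dirichlet_primitive th n phi : R :=
  phi + 2 * \sum_(i < n) cos (i.+1%:R * th) * (sin (i.+1%:R * phi) / i.+1%:R).

(** For [th] in (0, pi), the primitive [jump_primitive] vanishes at 0 and pi and tends to 1 / 2 at
    [th]. In the limit the kernel thus has mass 1 / 2 to the left of [th] and - 1 / 2 to the right,
    which extracts a jump. *)
Definition jump_kernel th n phi : R :=
  (\sum_(i < n) i.+1%:R * sin (i.+1%:R * th) * cos (i.+1%:R * phi)) / n%:R.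

Definition jump_primitive th n phi : R :=
  (\sum_(i < n) sin (i.+1%:R * th) * sin (i.+1%:R * phi)) / n%:R.

Lemma dirichlet_kernelE th n phi : dirichlet_kernel th n phi =
  1 + (\sum_(i < n) cos (i.+1%:R * (phi - th)) +
       \sum_(i < n) cos (i.+1%:R * (phi + th))).
Proof.
rewrite /dirichlet_kernel mulr_sumr -big_split/=; congr (_ + _).
apply: eq_bigr => i _; rewrite cos_cos_prod -(cosN (_ - _)).
by congr (cos _ + cos _); ring.
Qed.

Lemma dirichlet_primitiveE th n phi : dirichlet_primitive th n phi =
  sawtooth_sum n (phi - th) + sawtooth_sum n (phi + th).
Proof.
rewrite /dirichlet_primitive /sawtooth_sum addrACA -big_split/= mulr_sumr.
congr (_ + _); first by lra.
apply: eq_bigr => i _; rewrite mulrA mulrA -mulrDl; congr (_ / _).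
rewrite -mulrA [cos _ * _]mulrC sin_cos_prod addrC.
by congr (sin _ + sin _); ring.
Qed.

Lemma jump_kernelE th n phi : jump_kernel th n phi =
  (\sum_(i < n) i.+1%:R * sin (i.+1%:R * (phi + th)) -
   \sum_(i < n) i.+1%:R * sin (i.+1%:R * (phi - th))) / (2 * n%:R).
Proof.
rewrite /jump_kernel invfM mulrA -sumrB; congr (_ / _).
apply: (@mulfI _ 2) => //; rewrite mulrCA divff// mulr1 mulr_sumr.
apply: eq_bigr => i _; rewrite -mulrA mulrCA sin_cos_prod -[RHS]mulrBr -sinN.
by congr (_ * (sin _ + sin _)); ring.
Qed.

Lemma jump_primitiveE th n phi : jump_primitive th n phi =
  (\sum_(i < n) cos (i.+1%:R * (phi - th)) -
   \sum_(i < n) cos (i.+1%:R * (phi + th))) / (2 * n%:R).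
Proof.
rewrite /jump_primitive invfM mulrA -sumrB; congr (_ / _).
apply: (@mulfI _ 2) => //; rewrite mulrCA divff// mulr1 mulr_sumr.
apply: eq_bigr => i _; rewrite sin_sin_prod -(cosN (_ - _)).
by congr (cos _ - cos _); ring.
Qed.

Lemma ler_norm_sum_cos n (t : R) : `|\sum_(i < n) cos (i.+1%:R * t)| <= n%:R.
Proof.
apply: (le_trans (ler_norm_sum _ _ _)).
have -> : n%:R = \sum_(i < n) (1 : R) by rewrite sumr_const card_ord.
by apply: ler_sum => i _; apply: cos_max.
Qed.

Lemma ler_divr_of_mul (x y z c : R) : 0 < c -> 0 < y -> 0 <= x ->
  c * y <= z -> x * z <= 1 ->
  x <= c^-1 / y.
Proof.
move=> c0 y0 x0 cz xz; rewrite -invfM -[leRHS]mul1r ler_pdivlMr ?mulr_gt0//.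
by rewrite (le_trans _ xz)// ler_wpM2l.
Qed.

(** The primitive is a sum of two sawtooth sums. To the right of [th] all four values in the
    increment up to pi are close to pi / 2; to the left, oddness of the sawtooth turns the increment
    from 0 into a difference of two values close to pi / 2. *)
Lemma localized_dirichlet th : 0 < th < pi ->
  localized_kernel th (dirichlet_kernel th) (dirichlet_primitive th).
Proof.
move=> hth; have [c c0 hc] := half_angle_bound hth.
move: hth => /andP[th0 thpi]; have pi0 := pi_gt0 R.
have ci0 : 0 < c^-1 by rewrite invr_gt0.
(* The 3 pays for 1 + 2 n <= 3 n, the pi for 1 <= pi / |phi - th|, and the 4 for the four sawtooth
   errors to the right of [th]. *)
exists (3 + pi + 4 * c^-1) => n phi n0 /andP[phi0 phipi] phith.
have n0' : 1 <= n%:R :> R by rewrite ler1n.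
set d := `|phi - th|; have d0 : 0 < d by rewrite normr_gt0 subr_eq0.
have dpi : d <= pi by rewrite ler_norml; apply/andP; split; lra.
have di0 : 0 < d^-1 by rewrite invr_gt0.
have phiI : phi \in `[0, pi] by rewrite in_itv/= phi0.
have piI : (pi : R) \in `[0, pi] by rewrite in_itv/= lexx andbT ltW.
have saw t : c * d <= sin (t / 2) -> 0 < t < 2 * pi ->
    `|sawtooth_sum n t - pi / 2| <= c^-1 / (n%:R * d).
  move=> ht t0; apply: (le_trans (sawtooth_sum_bound n0 t0)).
  rewrite -invfM lef_pV2 ?posrE ?mulr_gt0 ?sin_half_gt0 ?ltr0n//.
  by rewrite mulrCA ler_wpM2l.
have [hc1 hc2] := hc _ phiI; have [hc3 hc4] := hc _ piI; rewrite -/d in hc1 hc2.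
have dpith : th < phi -> d <= `|pi - th|.
  by move=> h; rewrite /d !ger0_norm; lra.
have q0 : 0 < c^-1 / d by rewrite divr_gt0.
split.
- rewrite dirichlet_kernelE; apply: (le_trans (ler_normD _ _)).
  rewrite normr1; apply: (le_trans (lerD (lexx _) (ler_normD _ _))).
  have := ler_norm_sum_cos n (phi - th); have := ler_norm_sum_cos n (phi + th).
  have : 0 <= (pi + 4 * c^-1) * n%:R by rewrite mulr_ge0//; lra.
  by lra.
- rewrite dirichlet_kernelE; apply: (le_trans (ler_normD _ _)).
  rewrite normr1; apply: (le_trans (lerD (lexx _) (ler_normD _ _))).
  have := ler_divr_of_mul c0 d0 (normr_ge0 _) hc1 (ler_sum_cos n _).
  have := ler_divr_of_mul c0 d0 (normr_ge0 _) (le_trans hc2 (ler_norm _))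
    (ler_sum_cos n _).
  have : 1 <= pi / d by rewrite ler_pdivlMr// mul1r.
  have -> : (3 + pi + 4 * c^-1) / d = 3 / d + pi / d + 4 * (c^-1 / d) by ring.
  have : 0 < 3 / d by rewrite divr_gt0.
  by lra.
- move=> thphi; rewrite !dirichlet_primitiveE.
  have A1 : c * d <= sin ((phi - th) / 2).
    by rewrite (le_trans hc1)// ger0_norm// sin_ge0_pi//; apply/andP; split; lra.
  have A3 : c * d <= sin ((pi - th) / 2).
    rewrite (@le_trans _ _ (c * `|pi - th|)) ?ler_wpM2l ?(ltW c0) ?dpith//.
    by rewrite (le_trans hc3)// ger0_norm// sin_ge0_pi//; apply/andP; split; lra.
  have A4 : c * d <= sin ((pi + th) / 2).
    by rewrite (@le_trans _ _ (c * `|pi - th|)) ?ler_wpM2l ?(ltW c0) ?dpith.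
  have := saw (phi - th) A1; have := saw (phi + th) hc2.
  have := saw (pi - th) A3; have := saw (pi + th) A4.
  have h1 : 0 < phi - th < 2 * pi by apply/andP; split; lra.
  have h2 : 0 < phi + th < 2 * pi by apply/andP; split; lra.
  have h3 : 0 < pi - th < 2 * pi by apply/andP; split; lra.
  have h4 : 0 < pi + th < 2 * pi by apply/andP; split; lra.
  move=> /(_ h4) + /(_ h3) + /(_ h2) + /(_ h1); set E := c^-1 / _ => k1 k2 k3 k4.
  have -> : (3 + pi + 4 * c^-1) / (n%:R * d) =
    (3 + pi) / (n%:R * d) + 4 * E by rewrite /E; ring.
  have E0 : 0 <= (3 + pi) / (n%:R * d).
    by rewrite divr_ge0// ?mulr_ge0 ?ler0n ?(ltW d0)//; lra.
  have -> : sawtooth_sum n (pi - th) + sawtooth_sum n (pi + th) -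
      (sawtooth_sum n (phi - th) + sawtooth_sum n (phi + th)) =
    ((sawtooth_sum n (pi - th) - pi / 2) + (sawtooth_sum n (pi + th) - pi / 2)) -
    ((sawtooth_sum n (phi - th) - pi / 2) + (sawtooth_sum n (phi + th) - pi / 2)).
    by ring.
  apply: (le_trans (ler_normB _ _)).
  apply: (le_trans (lerD (ler_normD _ _) (ler_normD _ _))).
  by lra.
- move=> thphi; rewrite !dirichlet_primitiveE sub0r add0r sawtooth_sumN.
  have A1 : c * d <= sin ((th - phi) / 2).
    rewrite (le_trans hc1)// -normrN -sinN -mulNr opprB ger0_norm//.
    by rewrite sin_ge0_pi//; apply/andP; split; lra.
  have := saw (th - phi) A1; have := saw (phi + th) hc2.
  have h1 : 0 < th - phi < 2 * pi by apply/andP; split; lra.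
  have h2 : 0 < phi + th < 2 * pi by apply/andP; split; lra.
  have -> : sawtooth_sum n (phi - th) = - sawtooth_sum n (th - phi).
    by rewrite -sawtooth_sumN opprB.
  move=> /(_ h2) + /(_ h1); set E := c^-1 / _ => k1 k2.
  have -> : (3 + pi + 4 * c^-1) / (n%:R * d) =
    (3 + pi) / (n%:R * d) + 4 * E by rewrite /E; ring.
  have E0 : 0 <= (3 + pi) / (n%:R * d).
    by rewrite divr_ge0// ?mulr_ge0 ?ler0n ?(ltW d0)//; lra.
  have E1 : 0 <= E by rewrite /E divr_ge0 ?mulr_ge0 ?ler0n ?(ltW d0) ?(ltW ci0).
  have -> : - sawtooth_sum n (th - phi) + sawtooth_sum n (phi + th) -
      (- sawtooth_sum n th + sawtooth_sum n th) =
    (sawtooth_sum n (phi + th) - pi / 2) - (sawtooth_sum n (th - phi) - pi / 2).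
    by ring.
  by apply: (le_trans (ler_normB _ _)); lra.
Qed.

End Kernels.

Section JumpKernel.
Context {R : realType}.
Implicit Types (th phi : R).

(** Since the primitive vanishes at both ends, the last two bounds reduce to one on its value at
    [phi]: a difference of two cosine sums, each O(1 / |phi - th|), divided by 2 n. *)
Lemma localized_jump th : 0 < th < pi ->
  localized_kernel th (jump_kernel th) (jump_primitive th).
Proof.
move=> hth; have [c c0 hc] := half_angle_bound hth.
move: hth => /andP[th0 thpi]; have pi0 := pi_gt0 R.
have ci0 : 0 < c^-1 by rewrite invr_gt0.
exists (1 + 2 * c^-1) => n phi n0 /andP[phi0 phipi] phith.
have n0' : 1 <= n%:R :> R by rewrite ler1n.
have n0'' : 0 < n%:R :> R by rewrite ltr0n.
set d := `|phi - th|; have d0 : 0 < d by rewrite normr_gt0 subr_eq0.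
have phiI : phi \in `[0, pi] by rewrite in_itv/= phi0.
have [hc1 hc2] := hc _ phiI; rewrite -/d in hc1 hc2.
have q0 : 0 < c^-1 / d by rewrite divr_gt0.
have hc2' := le_trans hc2 (ler_norm _).
have Hb : `|jump_primitive th n phi| <= (1 + 2 * c^-1) / (n%:R * d).
  rewrite jump_primitiveE normrM normfV [`|2 * _|]ger0_norm; last by lra.
  rewrite ler_pdivrMr; last by lra.
  apply: (le_trans (ler_normB _ _)).
  have := ler_divr_of_mul c0 d0 (normr_ge0 _) hc1 (ler_sum_cos n _).
  have := ler_divr_of_mul c0 d0 (normr_ge0 _) hc2' (ler_sum_cos n _).
  have -> : (1 + 2 * c^-1) / (n%:R * d) * (2 * n%:R) = 2 / d + 4 * (c^-1 / d).
    by field; rewrite !gt_eqF.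
  have : 0 < 2 / d by rewrite divr_gt0.
  by lra.
have H0 : jump_primitive th n 0 = 0.
  by rewrite /jump_primitive big1 ?mul0r// => i _; rewrite mulr0 sin0 mulr0.
have Hpi : jump_primitive th n pi = 0.
  by rewrite /jump_primitive big1 ?mul0r// => i _; rewrite sin_natpi mulr0.
split; last 2 first.
- by rewrite Hpi sub0r normrN.
- by rewrite H0 subr0.
- rewrite /jump_kernel normrM normfV [`|n%:R|]ger0_norm ?ler0n//.
  rewrite ler_pdivrMr//; apply: (le_trans (ler_norm_sum _ _ _)).
  apply: (@le_trans _ _ (\sum_(i < n) n%:R)).
    apply: ler_sum => i _; rewrite normrM -[leRHS]mulr1 ler_pM ?cos_max//.
    rewrite normrM -[leRHS]mulr1 ler_pM ?sin_max// ger0_norm ?ler0n//.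
    by rewrite ler_nat.
  rewrite sumr_const card_ord -[_ *+ _]mulr_natr -mulrA -[leLHS]mul1r.
  by rewrite ler_wpM2r ?mulr_ge0 ?ler0n//; lra.
- rewrite jump_kernelE normrM normfV [`|2 * _|]ger0_norm; last by lra.
  rewrite ler_pdivrMr; last by lra.
  apply: (le_trans (ler_normB _ _)).
  have n2 : 0 < 2 * n%:R :> R by rewrite mulr_gt0.
  have hs (t : R) : `|\sum_(i < n) i.+1%:R * sin (i.+1%:R * t)| / (2 * n%:R) *
      `|sin (t / 2)| <= 1.
    by rewrite mulrAC ler_pdivrMr// mul1r; apply: ler_sum_weighted_sin.
  have := ler_divr_of_mul c0 d0 (divr_ge0 (normr_ge0 _) _) hc1 (hs _).
  have := ler_divr_of_mul c0 d0 (divr_ge0 (normr_ge0 _) _) hc2' (hs _).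
  move=> /(_ (ltW n2)) + /(_ (ltW n2)); rewrite !ler_pdivrMr//.
  set X := `|_|; set Y := `|_| => h1 h2.
  have -> : (1 + 2 * c^-1) / d * (2 * n%:R) =
    (2 * n%:R) / d + 2 * (c^-1 / d * (2 * n%:R)) by ring.
  have : 0 <= 2 * n%:R / d by rewrite divr_ge0 // ltW.
  by lra.
Qed.

End JumpKernel.

(** * The substitution t = cos phi *)

Section CosineSubstitution.
Context {R : realType}.
Notation mu := (@lebesgue_measure R).

Lemma cos_in_oo (x : R) : 0 < x < pi -> -1 < cos x < 1.
Proof.
move=> /andP[x0 xpi]; have h := pi_ge0 R; apply/andP; split.
  by rewrite -(@cospi R) ltr_cos ?in_itv/= ?lexx ?h// !ltW.
by rewrite -(@cos0 R) ltr_cos ?in_itv/= ?lexx ?h// !ltW.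
Qed.

Lemma constant_of_derive0 (F : R -> R) (a b x : R) :
  (forall t, t \in `]a, b[ -> is_derive t 1 F 0) ->
  {within `[a, b], continuous F} -> a <= x <= b -> F x = F b.
Proof.
move=> hF cF /andP[ax]; rewrite le_eqVlt => /predU1P[->//|xb].
have dF t : t \in `]x, b[ -> is_derive t 1 F ((fun=> 0 : R) t).
  rewrite in_itv/= => /andP[t1 t2]; apply: hF.
  by rewrite in_itv/= t2 (le_lt_trans ax).
have cF' : {within `[x, b], continuous F}.
  apply: continuous_subspaceW cF => t /=; rewrite !in_itv/= => /andP[t1 ->].
  by rewrite (le_trans ax).
have [c _] := MVT xb dF cF'.
by rewrite mul0r => /eqP; rewrite subr_eq0 => /eqP.
Qed.

(** If [F] is the primitive of [p] from the left, F (cos x) + S x has derivative 0 on (0, pi) and is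
    continuous up to the ends, hence constant. The ends are reached by continuity because [p] is to
    contain the weight, which is unbounded near -1 and 1. *)
Lemma integral_cos_substitution (p S : R -> R) (phi : R) :
  mu.-integrable `[-1, 1] (EFin \o p) ->
  (forall t, -1 < t < 1 -> {for t, continuous p}) ->
  (forall t, 0 < t < pi -> is_derive t 1 S (p (cos t) * sin t)) ->
  continuous S -> 0 <= phi <= pi ->
  \int[mu]_(t in `[-1, cos phi]) p t = S pi - S phi.
Proof.
move=> ip cp dS cS phi0pi.
(* Extension by 0 to [-2, 2] makes -1 and 1 interior points, so that [F] is continuous at every
   value of [cos]. *)
pose p0 := p \_ `[-1, 1].
have ip0 : mu.-integrable `[-2, 2] (EFin \o p0).
  rewrite /p0 -restrict_EFin; apply/integrable_restrict => //.
  rewrite setIidr// => t /=; rewrite !in_itv/= => /andP[? ?].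
  by apply/andP; split; lra.
pose F x := parameterized_integral mu (-2) x p0.
have cF x : -2 < x < 2 -> {for x, continuous F}.
  move=> hx; have lt22 : -2 < 2 :> R by lra.
  have := parameterized_integral_continuous (ltW lt22) ip0.
  by move=> /(continuous_within_itvP _ lt22)[h _ _]; apply: h; rewrite in_itv.
have FE x : -1 <= x <= 1 -> \int[mu]_(t in `[-1, x]) p t = F x.
  move=> /andP[x1 x2]; rewrite /F /parameterized_integral /p0.
  rewrite [RHS]Rintegral_mkcond [LHS]Rintegral_mkcond; congr (Rintegral _ _ _).
  apply/funext => t; rewrite !patchE !mem_setE/= !in_itv/=.
  case: (leP (-1) t) => h1; case: (leP t x) => h2 /=; rewrite ?andbF//; last first.
    by case: ifP.
  have -> : -2 <= t by lra.
  by have -> : t <= 1 by lra.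
rewrite FE; last by rewrite cos_geN1 cos_le1.
pose G x := F (cos x) + S x.
have cosin (x : R) : -2 < cos x < 2.
  by have := cos_geN1 x; have := cos_le1 x => h1 h2; apply/andP; split; lra.
have cG : continuous G.
  move=> x; apply: cvgD; last exact: cS.
  apply: (@continuous_comp _ _ _ cos F); first exact: continuous_cos.
  exact: cF (cosin x).
have dG x : x \in `]0, pi[ -> is_derive x 1 G 0.
  rewrite in_itv/= => /andP[x0 xpi].
  have lt0pi : 0 < x < pi by rewrite x0.
  have /andP[c2 c1] := cos_in_oo lt0pi.
  have [dF F'] : derivable F (cos x) 1 /\ derive1 F (cos x) = p0 (cos x).
    have /andP[h1 h2] := cosin x.
    apply: (continuous_FTC1_closed h2 ip0 h1).
    have near_p : \forall t \near cos x, p t = p0 t.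
      near=> t; rewrite /p0 patchE ifT// inE/= in_itv/=.
      apply/andP; split; apply: ltW; near: t;
        [exact: lt_nbhsr|exact: lt_nbhsl].
    suff : p0 t @[t --> cos x] --> p0 (cos x) by [].
    have -> : p0 (cos x) = p (cos x).
      by rewrite /p0 patchE ifT// inE/= in_itv/= !ltW.
    have := cp (cos x); rewrite c1 c2 => /(_ isT); apply: cvg_trans.
    by apply: near_eq_cvg; apply: filterS near_p => t ->.
  have dFx : is_derive (cos x) 1 F (p (cos x)).
    have -> : p (cos x) = p0 (cos x).
      by rewrite /p0 patchE ifT// inE/= in_itv/= !ltW.
    by rewrite -F' derive1E; apply: DeriveDef.
  have dSx := dS _ lt0pi.
  have dFc := is_derive1_comp dFx (is_derive_cos x).
  by have := is_deriveD dFc dSx; rewrite mulrN addNr.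
have := @constant_of_derive0 G 0 pi phi dG (continuous_subspaceT cG) phi0pi.
have FN1 : F (-1) = 0.
  by rewrite -FE ?set_itv1 ?Rintegral_set1//; apply/andP; split; lra.
by rewrite /G cospi FN1 add0r => <-; ring.
Unshelve. all: by end_near. Qed.

End CosineSubstitution.

(** * Integration against the Chebyshev weight *)

Section WeightedIntegral.
Context {R : realType}.
Notation mu := (@lebesgue_measure R).
Notation w := (@chebyshev_weight R).
Implicit Types (u v f : R -> R).

Lemma weight_ge0 t : 0 <= w t.
Proof. by rewrite mulr_ge0 ?powR_ge0. Qed.

Lemma weightE t : -1 < t < 1 -> w t = (Num.sqrt (1 - t ^+ 2))^-1.
Proof.
move=> /andP[t1 t2]; rewrite /chebyshev_weight !powRN -invfM.
have -> : 1 - t ^+ 2 = (1 - t) * (1 + t) by ring.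
have h1 : 0 <= 1 - t by lra.
have h2 : 0 <= 1 + t by lra.
by rewrite -powRM// powR12_sqrt// mulr_ge0.
Qed.

Lemma weight_cos phi : 0 < phi < pi -> w (cos phi) * sin phi = 1.
Proof.
move=> hphi; have s0 := sin_gt0_pi hphi.
by rewrite weightE ?cos_in_oo// -sin2cos2 sqrtr_sqr gtr0_norm// mulVf// gt_eqF.
Qed.

Lemma weight_ge1 t : -1 < t < 1 -> 1 <= w t.
Proof.
move=> ht; rewrite weightE//; move: ht => /andP[t1 t2].
have h0 : 0 < 1 - t ^+ 2.
  have -> : 1 - t ^+ 2 = (1 - t) * (1 + t) by ring.
  by rewrite mulr_gt0//; lra.
rewrite -[leLHS]invr1 lef_pV2 ?posrE ?sqrtr_gt0//.
by rewrite -[leRHS](@sqrtr1 R) ler_wsqrtr// gerBl sqr_ge0.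
Qed.

Lemma measurable_weight : measurable_fun setT w.
Proof.
apply: measurable_funM.
- apply: (measurableT_comp (measurable_powR _)).
  exact: measurable_funB.
- apply: (measurableT_comp (measurable_powR _)).
  exact: measurable_funD.
Qed.

Lemma continuous_weight t : -1 < t < 1 -> {for t, continuous w}.
Proof.
move=> /andP[t1 t2].
have E : \forall s \near t, (Num.sqrt (1 - s ^+ 2))^-1 = w s.
  near=> s; rewrite weightE//; apply/andP; split; near: s;
    [exact: lt_nbhsr|exact: lt_nbhsl].
suff : w s @[s --> t] --> w t by [].
rewrite [in X in _ --> X]weightE ?t1//.
have h0 : 0 < 1 - t ^+ 2.
  have -> : 1 - t ^+ 2 = (1 - t) * (1 + t) by ring.
  by rewrite mulr_gt0//; lra.
suff : (Num.sqrt (1 - s ^+ 2))^-1 @[s --> t] --> (Num.sqrt (1 - t ^+ 2))^-1.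
  by apply: cvg_trans; apply: near_eq_cvg; apply: filterS E => s ->.
apply: cvgV; first by rewrite gt_eqF// sqrtr_gt0.
apply: (@continuous_comp _ _ _ (fun s : R => 1 - s ^+ 2) (@Num.sqrt R)).
  by apply: cvgB; [exact: cvg_cst|exact: exprn_continuous].
exact: sqrt_continuous.
Unshelve. all: by end_near. Qed.

(** [P 0] is a nonzero constant, so by orthonormality a positive multiple of the weight has integral
    1. Were the integral infinite, its real value would be 0, the default of [fine] at +oo. *)
Lemma weight_integrable P : @chebyshev_orthonormal R P ->
  mu.-integrable `[-1, 1] (EFin \o w).
Proof.
move=> [hs _ /(_ 0%N 0%N)].
have /size_poly1P[c c0 ->] : size (P 0%N) == 1%N by rewrite hs.
under eq_Rintegral do rewrite hornerC.
rewrite eqxx => h1.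
have hw : mu.-integrable `[-1, 1] (EFin \o (fun t => c * c * w t)).
  apply/integrableP; split.
    apply/measurable_EFinP; apply: measurable_funM => //.
    by apply: measurable_funTS; exact: measurable_weight.
  rewrite ltey; apply/eqP => hoo.
  move: h1; rewrite /Rintegral.
  under eq_integral.
    move=> t _; rewrite -[EFin _]gee0_abs ?lee_fin; last first.
      by rewrite mulr_ge0 ?weight_ge0// -expr2 sqr_ge0.
    over.
  by move: hoo => /= ->/= => /eqP; rewrite eq_sym oner_eq0.
have := @integrableZl _ _ _ mu _ (measurable_itv _) (c * c)^-1 _ hw.
apply: eq_integrable => // t _ /=.
by rewrite -EFinM mulrA mulVf ?mul1r// mulf_neq0.
Qed.

Definition bounded_measurable u :=
  measurable_fun (`[-1, 1]%classic : set (measurableTypeR R)) u /\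
  exists C, {in `[-1, 1], forall t, `|u t| <= C}.

Lemma bounded_measurable_cst (c : R) : bounded_measurable (fun=> c).
Proof. by split; [exact: measurable_cst|exists `|c|]. Qed.

Lemma bounded_measurableD u v : bounded_measurable u -> bounded_measurable v ->
  bounded_measurable (fun t => u t + v t).
Proof.
move=> [mu' [C hC]] [mv [D hD]]; split; first exact: measurable_funD.
exists (C + D) => t ht; apply: (le_trans (ler_normD _ _)).
by rewrite lerD ?hC ?hD.
Qed.

Lemma bounded_measurableM u v : bounded_measurable u -> bounded_measurable v ->
  bounded_measurable (fun t => u t * v t).
Proof.
move=> [mu' [C hC]] [mv [D hD]]; split; first exact: measurable_funM.
by exists (C * D) => t ht; rewrite normrM ler_pM ?hC ?hD.
Qed.

Lemma bounded_measurable_norm u : bounded_measurable u ->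
  bounded_measurable (fun t => `|u t|).
Proof.
move=> [mu' [C hC]]; split; first exact: measurableT_comp.
by exists C => t ht; rewrite normr_id hC.
Qed.

Lemma bounded_measurable_poly (p : {poly R}) : bounded_measurable (horner p).
Proof.
split.
  apply: measurable_funTS; apply: continuous_measurable_fun.
  exact: continuous_horner.
exists (\sum_(i < size p) `|p`_i|) => t; rewrite in_itv/= => /andP[t1 t2].
rewrite horner_coef (le_trans (ler_norm_sum _ _ _))//; apply: ler_sum => i _.
rewrite normrM ler_piMr// normrX exprn_ile1// ler_norml.
by rewrite t1.
Qed.

Definition wint u : R := \int[mu]_(t in `[-1, 1]) (u t * w t).

Context (iw : mu.-integrable `[-1, 1] (EFin \o w)).

Lemma integrable_weighted u : bounded_measurable u ->
  mu.-integrable `[-1, 1] (EFin \o (fun t => u t * w t)).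
Proof.
move=> [mu' [C hC]].
have := @integrableMr _ _ _ mu _ (measurable_itv `[-1, 1]) u _ mu' _ iw.
apply; exists C; split; first exact: num_real.
by move=> M CM t ht /=; rewrite (le_trans _ (ltW CM))// hC.
Qed.

Lemma eq_wint u v : {in `[-1, 1], u =1 v} -> wint u = wint v.
Proof.
by move=> h; apply: eq_Rintegral => t; rewrite inE/= => ht; rewrite h.
Qed.

Lemma wintD u v : bounded_measurable u -> bounded_measurable v ->
  wint (fun t => u t + v t) = wint u + wint v.
Proof.
move=> hu hv; rewrite /wint -RintegralD//; last 2 first.
- exact: integrable_weighted.
- exact: integrable_weighted.
by apply: eq_Rintegral => t _; rewrite mulrDl.
Qed.

Lemma wintZ c u : bounded_measurable u ->
  wint (fun t => c * u t) = c * wint u.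
Proof.
move=> hu; rewrite /wint -RintegralZl//; last exact: integrable_weighted.
by apply: eq_Rintegral => t _; rewrite mulrA.
Qed.

Lemma wintB u v : bounded_measurable u -> bounded_measurable v ->
  wint (fun t => u t - v t) = wint u - wint v.
Proof.
move=> hu hv; rewrite /wint -RintegralB//; last 2 first.
- exact: integrable_weighted.
- exact: integrable_weighted.
by apply: eq_Rintegral => t _; rewrite mulrBl.
Qed.

Lemma wint_ge0 u : {in `[-1, 1], forall t, 0 <= u t} -> 0 <= wint u.
Proof.
by move=> h; apply: Rintegral_ge0 => t ht; rewrite mulr_ge0 ?weight_ge0 ?h.
Qed.

Lemma wint_le u v : bounded_measurable u -> bounded_measurable v ->
  {in `[-1, 1], forall t, u t <= v t} -> wint u <= wint v.
Proof.
move=> hu hv h; apply: le_Rintegral => //; try exact: integrable_weighted.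
by move=> t ht; rewrite ler_wpM2r ?weight_ge0 ?h.
Qed.

Lemma wint_cos (q : {poly R}) (S : R -> R) (phi : R) :
  (forall t : R, is_derive t 1 S q.[cos t]) -> 0 <= phi <= pi ->
  \int[mu]_(t in `[-1, cos phi]) (q.[t] * w t) = S pi - S phi.
Proof.
move=> dS hphi.
apply: (@integral_cos_substitution R (fun t => q.[t] * w t) S phi _ _ _ _ hphi).
- exact: (integrable_weighted (bounded_measurable_poly q)).
- move=> t ht; apply: cvgM; first exact: continuous_horner.
  exact: continuous_weight.
- move=> t ht /=.
  by rewrite -mulrA weight_cos ?mulr1.
- move=> t; apply: differentiable_continuous; apply/derivable1_diffP.
  by have [] := dS t.
Qed.

(** [cos] reverses orientation, hence the minus sign: increments over [c, d] become integrals over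
    ]cos d, cos c[, where the weight has integral d - c. What remains is the trivial bound for the
    integral of (f - v) q w. *)
Lemma primitive_pair_weighted f (q : {poly R}) (k H : R -> R) :
  bounded_measurable f -> (forall t, k t = q.[cos t]) ->
  (forall t : R, is_derive t 1 H (k t)) ->
  primitive_pair 0 pi (f \o cos) k H
    (fun phi => - \int[mu]_(t in `[-1, cos phi]) (f t * q.[t] * w t)).
Proof.
move=> bf kE dH c d v M B c0 cd dpi hM hB.
have hc : 0 <= c <= pi by apply/andP; split; lra.
have hd : 0 <= d <= pi by apply/andP; split; lra.
have cosdc : cos d < cos c by rewrite ltr_cos// in_itv.
have bq := bounded_measurable_poly q.
have bfq := bounded_measurableM bf bq.
have sub : `]cos d, cos c[ `<=` `[-1, 1].
  move=> t /=; rewrite !in_itv/= => /andP[t1 t2].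
  by rewrite (le_trans (cos_geN1 d) (ltW t1)) (le_trans (ltW t2) (cos_le1 c)).
have diff u : bounded_measurable u ->
    \int[mu]_(t in `[-1, cos c]) (u t * w t) - \int[mu]_(t in `[-1, cos d]) (u t * w t)
    = \int[mu]_(t in `]cos d, cos c[) (u t * w t).
  move=> /integrable_weighted bu.
  rewrite Rintegral_itvB ?bnd_simp ?cos_geN1 ?(ltW cosdc)//; last first.
    apply: integrableS bu => // t /=; rewrite !in_itv/= => /andP[-> t2].
    exact: le_trans t2 (cos_le1 c).
  by rewrite Rintegral_itv_bndo_bndc//; apply: integrableS bu.
have int u : bounded_measurable u ->
    mu.-integrable `]cos d, cos c[ (EFin \o (fun t => u t * w t)).
  by move=> /integrable_weighted; apply: integrableS.
have dH' (t : R) : is_derive t 1 H q.[cos t] by rewrite -kE.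
have HE : H d - H c = \int[mu]_(t in `]cos d, cos c[) (q.[t] * w t).
  by rewrite -diff// !(wint_cos dH')//; ring.
have idE (t : R) : is_derive t 1 (id : R -> R) (1%:P : {poly R}).[cos t].
  by rewrite hornerC; exact: is_derive_id.
have dcE : d - c = \int[mu]_(t in `]cos d, cos c[) (1 * w t).
  rewrite -(diff (fun=> 1)); last exact: bounded_measurable_cst.
  have E x : 0 <= x <= pi -> \int[mu]_(t in `[-1, cos x]) (1 * w t) = pi - x.
    move=> hx; rewrite -(wint_cos idE hx); apply: eq_Rintegral => t _.
    by rewrite hornerC.
  by rewrite !E//; ring.
have -> : - (\int[mu]_(t in `[-1, cos d]) (f t * q.[t] * w t)) -
    - (\int[mu]_(t in `[-1, cos c]) (f t * q.[t] * w t)) =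
    \int[mu]_(t in `]cos d, cos c[) (f t * q.[t] * w t).
  by rewrite -(diff (fun t => f t * q.[t]))//; ring.
have bfv : bounded_measurable (fun t => (f t + - v) * q.[t]).
  apply: bounded_measurableM => //; apply: bounded_measurableD => //.
  exact: bounded_measurable_cst.
have -> : \int[mu]_(t in `]cos d, cos c[) (f t * q.[t] * w t) - v * (H d - H c) =
   \int[mu]_(t in `]cos d, cos c[) ((f t + - v) * q.[t] * w t).
  rewrite HE -RintegralZl//; last exact: int.
  rewrite -RintegralB//; last 2 first.
  - exact: (int (fun t => f t * q.[t])).
  - exact: integrableZl (int _ bq).
  by apply: eq_Rintegral => t _; ring.
have i1 := int _ bfv; have i2 := int _ (bounded_measurable_cst 1).
apply: (le_trans (le_normr_Rintegral _ _)) => //.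
rewrite dcE -RintegralZl//; apply: le_Rintegral => //.
- exact: integrable_norm i1.
- exact: integrableZl i2.
move=> t; rewrite /= in_itv/= => /andP[t1 t2].
have t3 : -1 <= t <= 1 by have := sub t; rewrite /= !in_itv/= t1 t2; apply.
rewrite mul1r normrM (ger0_norm (weight_ge0 _)) ler_wpM2r ?weight_ge0//.
have tcos : cos (acos t) = t by rewrite acosK// in_itv.
have ac : acos t \in `]c, d[.
  have aI : acos t \in `[0, pi] by rewrite in_itv/= acos_ge0// acos_lepi.
  have cI : c \in `[0, pi] by rewrite in_itv.
  have dI : d \in `[0, pi] by rewrite in_itv.
  by rewrite in_itv/= -(ltr_cos cI aI) -(ltr_cos aI dI) tcos t1 t2.
have := hM _ ac; have := hB _ ac; rewrite kE /= tcos => h1 h2.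
by rewrite normrM ler_pM.
Qed.

End WeightedIntegral.

(** * Chebyshev polynomials and the orthonormal system *)

Section ChebyshevPolynomials.
Context {R : realType}.
Notation mu := (@lebesgue_measure R).
Notation w := (@chebyshev_weight R).
Implicit Types p q : {poly R}.

Fixpoint cheb n : {poly R} := match n with
  | 0 => 1
  | 1 => 'X
  | (n'.+1 as m).+1 => 2 *: ('X * cheb m) - cheb n'
  end.

Lemma chebSS n : cheb n.+2 = 2 *: ('X * cheb n.+1) - cheb n.
Proof. by []. Qed.

Lemma size_cheb n : size (cheb n) = n.+1.
Proof.
suff [] : size (cheb n) = n.+1 /\ size (cheb n.+1) = n.+2 by [].
elim: n => [|n [IH1 IH2]]; first by rewrite size_poly1 size_polyX.
split=> //; rewrite chebSS.
have h : size (2 *: ('X * cheb n.+1)) = n.+3.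
  by rewrite size_scale ?pnatr_eq0// mulrC size_mulX ?IH2// -size_poly_eq0 IH2.
by rewrite size_polyDl h// size_polyN IH1 leqW.
Qed.

Lemma horner_cheb n (t : R) : (cheb n).[cos t] = cos (n%:R * t).
Proof.
suff [] : (cheb n).[cos t] = cos (n%:R * t) /\
    (cheb n.+1).[cos t] = cos (n.+1%:R * t) by [].
elim: n => [|n [IH1 IH2]]; first by rewrite hornerC hornerX mul0r cos0 mul1r.
split=> //; rewrite chebSS hornerD hornerN hornerZ hornerM hornerX IH1 IH2 cos_cos_prod.
have -> : t - n.+1%:R * t = - (n%:R * t) by rewrite -(natr1 n); ring.
have -> : t + n.+1%:R * t = n.+2%:R * t by rewrite -(natr1 n.+1); ring.
by rewrite cosN; ring.
Qed.

Lemma poly_basis (Q : nat -> {poly R}) n p : (forall k, size (Q k) = k.+1) ->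
  (size p <= n)%N -> exists c : nat -> R, p = \sum_(k < n) c k *: Q k.
Proof.
move=> sQ; elim: n p => [|n IH] p sp.
  by exists (fun=> 0); rewrite big_ord0; apply/eqP; rewrite -size_poly_leq0.
have lQ : (Q n)`_n != 0.
  by have := lead_coef_eq0 (Q n); rewrite lead_coefE sQ/= => ->; rewrite -size_poly_eq0 sQ.
have [|c hc] := IH (p - (p`_n / (Q n)`_n) *: Q n).
  apply/leq_sizeP => j; rewrite leq_eqVlt => /predU1P[<-|nj].
    by rewrite coefB coefZ divfK// subrr.
  rewrite coefB coefZ (nth_default 0 (leq_trans sp nj)).
  by rewrite [(Q n)`_j]nth_default ?sQ// mulr0 subrr.
exists (fun k => if k == n then p`_n / (Q n)`_n else c k).
rewrite big_ord_recr/= eqxx.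
rewrite (eq_bigr (fun k : 'I_n => c k *: Q k)) => [|i _].
  by rewrite -hc subrK.
by rewrite ltn_eqF.
Qed.

Context (iw : mu.-integrable `[-1, 1] (EFin \o w)).

Definition wpoly p := wint (horner p).

Lemma wpolyD p q : wpoly (p + q) = wpoly p + wpoly q.
Proof.
rewrite /wpoly -wintD//; try exact: bounded_measurable_poly.
by apply: eq_wint => t _; rewrite hornerD.
Qed.

Lemma wpolyZ c p : wpoly (c *: p) = c * wpoly p.
Proof.
rewrite /wpoly -wintZ//; last exact: bounded_measurable_poly.
by apply: eq_wint => t _; rewrite hornerZ.
Qed.

Lemma wpoly0 : wpoly 0 = 0.
Proof. by rewrite -[0](scale0r (1 : {poly R})) wpolyZ mul0r. Qed.

Lemma wpoly_sum n (c : nat -> R) (Q : nat -> {poly R}) p :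
  wpoly ((\sum_(k < n) c k *: Q k) * p) = \sum_(k < n) c k * wpoly (Q k * p).
Proof.
rewrite mulr_suml (big_morph _ wpolyD wpoly0).
by apply: eq_bigr => k _; rewrite -scalerAl wpolyZ.
Qed.

Lemma wpolyE p (S : R -> R) : (forall t : R, is_derive t 1 S p.[cos t]) ->
  wpoly p = S pi - S 0.
Proof.
move=> dS; rewrite -(@wint_cos _ iw p S 0 dS) ?lexx ?pi_ge0//.
by rewrite cos0.
Qed.

Lemma wpoly_cheb_ortho n m : n != m -> wpoly (cheb n * cheb m) = 0.
Proof.
move=> nm; have d0 : n%:R - m%:R != 0 :> R by rewrite subr_eq0 eqr_nat.
have s0 : n%:R + m%:R != 0 :> R.
  by rewrite -natrD pnatr_eq0 addn_eq0; apply: contra nm => /andP[/eqP-> /eqP->].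
pose S (t : R) := 2^-1 * (sin ((n%:R - m%:R) * t) / (n%:R - m%:R) +
  sin ((n%:R + m%:R) * t) / (n%:R + m%:R)).
have dS (t : R) : is_derive t 1 S (cheb n * cheb m).[cos t].
  rewrite hornerM !horner_cheb /S; apply: is_derive_eq.
  have -> : cos (n%:R * t) * cos (m%:R * t) =
      2^-1 * (cos ((n%:R - m%:R) * t) + cos ((n%:R + m%:R) * t)).
    apply: (@mulfI _ 2) => //; rewrite cos_cos_prod mulVKf//.
    by congr (cos _ + cos _); ring.
  by rewrite /GRing.scale/=; field; rewrite d0 s0.
rewrite (wpolyE dS) /S !mulr0 sin0 !mul0r addr0 mulr0 subr0 mulrBl mulrDl.
by rewrite sinB sinD !sin_natpi !mul0r !mulr0 !addr0 subr0 !mul0r addr0 mulr0.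
Qed.

Lemma wpoly_cheb_sqr n : (0 < n)%N -> wpoly (cheb n * cheb n) = pi / 2.
Proof.
move=> n0; have n0' : n%:R != 0 :> R by rewrite pnatr_eq0 -lt0n.
pose S (t : R) := 2^-1 * (t + sin ((n%:R + n%:R) * t) / (n%:R + n%:R)).
have s0 : n%:R + n%:R != 0 :> R by rewrite -natrD pnatr_eq0 addnn double_eq0 -lt0n.
have dS (t : R) : is_derive t 1 S (cheb n * cheb n).[cos t].
  rewrite hornerM !horner_cheb /S; apply: is_derive_eq.
  have -> : cos (n%:R * t) * cos (n%:R * t) =
      2^-1 * (1 + cos ((n%:R + n%:R) * t)).
    apply: (@mulfI _ 2) => //; rewrite cos_cos_prod mulVKf// subrr cos0.
    by congr (_ + cos _); ring.
  by rewrite /GRing.scale/=; field; rewrite s0.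
rewrite (wpolyE dS) /S !mulr0 sin0 !mul0r addr0 mulr0 subr0 mulrDl.
by rewrite sinD !sin_natpi !mul0r !mulr0 !addr0 !mul0r addr0 mulrC.
Qed.

Lemma wpoly_cheb0 : wpoly (cheb 0 * cheb 0) = pi.
Proof.
have dS (t : R) : is_derive t 1 (id : R -> R) (cheb 0 * cheb 0).[cos t].
  by rewrite /= mulr1 hornerC; exact: is_derive_id.
by rewrite (wpolyE dS) subr0.
Qed.

(** The reciprocal of the weighted squared norm of [cheb n]. *)
Definition cheb_norm2 n : R := if n is 0 then pi^-1 else 2 / pi.

(** [P k] is orthogonal to every [cheb j] with j < k, a combination of [P 0], ..., [P j], so only
    the top term of its expansion survives. The square of [al] is what the series sees: each term
    a_k P_k contains [al k] twice. *)
Lemma orthonormal_chebE (P : nat -> {poly R}) : chebyshev_orthonormal P ->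
  exists2 al : nat -> R, (forall k, P k = al k *: cheb k) &
    forall k, al k ^+ 2 = cheb_norm2 k.
Proof.
move=> [sP _ oP].
have oP' n m : wpoly (P n * P m) = (n == m)%:R.
  rewrite -oP /wpoly /wint; apply: eq_Rintegral => t _.
  by rewrite hornerM.
have sq n : wpoly (cheb n * cheb n) = (cheb_norm2 n)^-1.
  by case: n => [|n]; rewrite ?wpoly_cheb0 ?wpoly_cheb_sqr//= ?invrK// invf_div.
have sq0 n : wpoly (cheb n * cheb n) != 0.
  have h := pi_gt0 R; rewrite sq invr_eq0 gt_eqF//.
  by case: n => [|n] /=; rewrite ?invr_gt0// divr_gt0.
have H k : exists a, P k = a *: cheb k.
  have [|c hc] := @poly_basis cheb k.+1 (P k) size_cheb; first by rewrite sP.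
  exists (c k); rewrite hc big_ord_recr/= big1 ?add0r// => j _.
  suff : wpoly (P k * cheb j) = 0.
    rewrite hc wpoly_sum (bigD1 (widen_ord (leqnSn k) j))//= big1 ?addr0.
      move=> /eqP; rewrite mulf_eq0 (negbTE (sq0 _)) orbF => /eqP->.
      by rewrite scale0r.
    by move=> i ij; rewrite wpoly_cheb_ortho ?mulr0.
  have [|d hd] := @poly_basis P j.+1 (cheb j) sP; first by rewrite size_cheb.
  rewrite mulrC hd wpoly_sum big1// => i _.
  rewrite oP' ltn_eqF ?mulr0//.
  by apply: leq_trans (ltn_ord j); exact: ltn_ord.
have [al hal] := choice H.
exists al => // k.
have := oP' k k; rewrite eqxx hal -scalerAl wpolyZ -scalerAr wpolyZ sq.
have N0 : cheb_norm2 k != 0 by rewrite -invr_eq0 -sq.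
by move=> h; rewrite -[LHS](divfK N0) expr2 -(mulrA (al k)) h mul1r.
Qed.

End ChebyshevPolynomials.

(** * Bessel's inequality and mean convergence of the residuals *)

Section Bessel.
Context {R : realType}.
Notation mu := (@lebesgue_measure R).
Notation w := (@chebyshev_weight R).
Context (iw : mu.-integrable `[-1, 1] (EFin \o w)).
Context (P : nat -> {poly R}) (oP : forall n m, wpoly (P n * P m) = (n == m)%:R).
Context (f : R -> R) (bf : bounded_measurable f).

(** Where the series converges to [f], this is the tail of order [N]; being a finite expression, it
    inherits boundedness and measurability from [f]. *)
Definition residual N t := f t - \sum_(k < N) fourier_chebyshev_coef P f k * (P k).[t].

Local Notation a := (fourier_chebyshev_coef P f).

Lemma residual0 t : residual 0 t = f t.
Proof. by rewrite /residual big_ord0 subr0. Qed.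

Lemma residualS N t : residual N.+1 t = residual N t - a N * (P N).[t].
Proof. by rewrite /residual big_ord_recr/= opprD addrA. Qed.

Lemma bounded_measurable_residual N : bounded_measurable (residual N).
Proof.
elim: N => [|N IH].
  by have -> : residual 0 = f by apply/funext => t; rewrite residual0.
have -> : residual N.+1 = (fun t => residual N t + - a N * (P N).[t]).
  by apply/funext => t; rewrite residualS mulNr.
apply: bounded_measurableD => //; apply: bounded_measurableM.
  exact: bounded_measurable_cst.
exact: bounded_measurable_poly.
Qed.

Lemma wint_residual N m : (N <= m)%N -> wint (fun t => residual N t * (P m).[t]) = a m.
Proof.
elim: N => [|N IH] Nm.
  by rewrite -[RHS]/(wint _); apply: eq_wint => t _; rewrite residual0.
have h1 : bounded_measurable (fun t => residual N t * (P m).[t]).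
  apply: bounded_measurableM; first exact: bounded_measurable_residual.
  exact: bounded_measurable_poly.
rewrite -[RHS](IH (ltnW Nm)) -[RHS]subr0.
have -> : 0 = a N * wpoly (P N * P m) by rewrite oP ltn_eqF// mulr0.
rewrite -wintZ//; last exact: bounded_measurable_poly.
rewrite -wintB//; last first.
  apply: bounded_measurableM; first exact: bounded_measurable_cst.
  exact: bounded_measurable_poly.
by apply: eq_wint => t _; rewrite residualS hornerM; ring.
Qed.

Lemma wint_residual_sqr N : wint (fun t => residual N.+1 t ^+ 2) =
  wint (fun t => residual N t ^+ 2) - a N ^+ 2.
Proof.
have br := bounded_measurable_residual N.
have b1 : bounded_measurable (fun t => residual N t ^+ 2).
  by have := bounded_measurableM br br.
have b2 : bounded_measurable (fun t => residual N t * (P N).[t]).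
  by apply: bounded_measurableM => //; exact: bounded_measurable_poly.
have b3 := bounded_measurable_poly (P N * P N).
have b4 : bounded_measurable (fun t => 2 * a N * (residual N t * (P N).[t])).
  by apply: bounded_measurableM => //; exact: bounded_measurable_cst.
have b5 : bounded_measurable (fun t => a N ^+ 2 * (P N * P N).[t]).
  by apply: bounded_measurableM => //; exact: bounded_measurable_cst.
transitivity (wint (fun t => residual N t ^+ 2 -
    2 * a N * (residual N t * (P N).[t]) + a N ^+ 2 * (P N * P N).[t])).
  by apply: eq_wint => t _; rewrite residualS hornerM; ring.
rewrite wintD//; last first.
  have -> : (fun t => residual N t ^+ 2 - 2 * a N * (residual N t * (P N).[t])) =
    (fun t => residual N t ^+ 2 + (- 1) * (2 * a N * (residual N t * (P N).[t]))).
    by apply/funext => t; rewrite mulN1r.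
  apply: bounded_measurableD => //; apply: bounded_measurableM => //.
  exact: bounded_measurable_cst.
rewrite wintB// !wintZ// wint_residual//.
by rewrite -[wint (horner _)]/(wpoly _) oP eqxx/=; ring.
Qed.

Lemma wint_residual_bound N :
  wint (fun t => residual N t ^+ 2) <= wint (fun t => f t ^+ 2).
Proof.
elim: N => [|N IH].
  by rewrite (@eq_wint _ _ (fun t => f t ^+ 2))// => t _; rewrite residual0.
by rewrite wint_residual_sqr (le_trans _ IH)// gerBl sqr_ge0.
Qed.

(** The squared norms of the residuals decrease and are nonnegative, hence converge; the squares of
    the coefficients are their consecutive differences. *)
Lemma fourier_chebyshev_coef_cvg0 : a n @[n --> \oo] --> (0 : R).
Proof.
pose E N := wint (fun t => residual N t ^+ 2).
have cE : cvgn E.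
  apply: nonincreasing_is_cvgn.
    apply/nonincreasing_seqP => N.
    by rewrite /E wint_residual_sqr gerBl sqr_ge0.
  by exists 0 => _ [N _ <-]; apply: wint_ge0 => t _; exact: sqr_ge0.
have h : a n ^+ 2 @[n --> \oo] --> (0 : R).
  have cE' : E n.+1 @[n --> \oo] --> limn E by rewrite cvg_shiftS.
  rewrite -(subrr (limn E)).
  apply: (@cvg_eq_fun _ (fun n => E n - E n.+1)) => [n|].
    by rewrite /E wint_residual_sqr; ring.
  by apply: cvgB.
apply/cvgr0Pnorm_lt => e e0.
have e20 : 0 < e ^+ 2 by rewrite exprn_gt0.
move/cvgr0Pnorm_lt : h => /(_ _ e20) h; near=> n.
have : `|a n ^+ 2| < e ^+ 2 by near: n.
by rewrite normrX ltr_pXn2r ?nnegrE ?(ltW e0).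
Unshelve. all: by end_near. Qed.

(** The residuals have no evident common majorant. Truncated at [M] they are dominated by [M * w],
    and the part above [M] is at most residual^2 / M, whose integral is at most K / M by Bessel's
    inequality, uniformly in N. *)
Lemma wint_norm_residual_cvg0 (D : set R) : countable D ->
  (forall t, -1 <= t <= 1 -> ~ D t -> residual N t @[N --> \oo] --> (0 : R)) ->
  wint (fun t => `|residual N t|) @[N --> \oo] --> (0 : R).
Proof.
move=> cD hD; pose K := wint (fun t => f t ^+ 2).
have K0 : 0 <= K by apply: wint_ge0 => t _; exact: sqr_ge0.
have bm (M : R) N : bounded_measurable (fun t => Num.min `|residual N t| M).
  have [mr [C hC]] := bounded_measurable_residual N; split.
    by apply: measurable_minr => //; apply: measurableT_comp.
  exists (Num.max C `|M|) => t ht; rewrite /Num.min; case: ifP => _.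
    by rewrite normr_id le_max hC.
  by rewrite le_max lexx orbT.
have trunc0 (M : R) : 0 < M ->
    wint (fun t => Num.min `|residual N t| M) @[N --> \oo] --> (0 : R).
  move=> M0; pose g n t := Num.min `|residual n t| M * w t.
  have m1 n : measurable_fun (`[-1, 1]%classic : set (measurableTypeR R))
      (EFin \o g n).
    by have /integrableP[] := integrable_weighted iw (bm M n).
  have aecvg : {ae mu, forall x, `[-1, 1]%classic x ->
      (EFin \o g n) x @[n --> \oo] --> (cst 0%E : R -> \bar R) x}.
    exists D; split.
    - exact: countable_measurable.
    - exact: countable_lebesgue_measure0.
    move=> t /= ht; apply: contrapT => nD; apply: ht => htI.
    apply/cvg_EFin; first by apply: nearW.
    rewrite -(mul0r (w t)); apply: cvgMl.
    apply: (@squeeze_cvgr _ _ _ _ (fun=> 0) (fun n => `|residual n t|)).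
    - by apply: nearW => n; rewrite le_min normr_ge0 ltW//= ge_min lexx.
    - exact: cvg_cst.
    - by rewrite -(normr0 R); apply: cvg_norm; apply: hD => //; move: htI; rewrite in_itv.
  have ig : mu.-integrable `[-1, 1] (EFin \o (fun t => M * w t)).
    by have := integrable_weighted iw (bounded_measurable_cst M).
  have dom : {ae mu, forall x n, `[-1, 1]%classic x ->
     (`|(EFin \o g n) x| <= (EFin \o (fun t => M * w t)%R) x)%E}.
    apply: aeW => t n ht /=; rewrite /g lee_fin normrM (ger0_norm (weight_ge0 _)).
    rewrite ler_wpM2r ?weight_ge0// ger0_norm ?ge_min ?lexx ?orbT//.
    by rewrite le_min normr_ge0 ltW.
  have mz : measurable_fun (`[-1, 1]%classic : set (measurableTypeR R))
      (cst 0%E : R -> \bar R) by exact: measurable_cst.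
  have [_ _] := @dominated_convergence _ _ R mu `[-1, 1]%classic (measurable_itv _)
    (fun n => EFin \o g n) (cst 0%E) (EFin \o (fun t => M * w t)) m1 mz aecvg ig dom.
  rewrite integral0 => /fine_cvg/=; exact.
have key (M : R) N : 0 < M -> wint (fun t => `|residual N t|) <=
    wint (fun t => Num.min `|residual N t| M) + K / M.
  move=> M0; have br := bounded_measurable_residual N.
  have b2 : bounded_measurable (fun t => residual N t ^+ 2).
    by have := bounded_measurableM br br.
  have b3 : bounded_measurable (fun t => M^-1 * residual N t ^+ 2).
    by apply: bounded_measurableM => //; exact: bounded_measurable_cst.
  apply: (@le_trans _ _ (wint (fun t => Num.min `|residual N t| M +
      M^-1 * residual N t ^+ 2))).
    apply: wint_le => //; first exact: bounded_measurable_norm.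
      exact: bounded_measurableD.
    move=> t _; rewrite /Num.min; case: ltP => h.
      by rewrite lerDl mulr_ge0// ?invr_ge0 ?sqr_ge0// ltW.
    apply: (@le_trans _ _ (M^-1 * residual N t ^+ 2)); last by rewrite lerDr ltW.
    by rewrite mulrC ler_pdivlMr// -normr_id -real_normK ?num_real// expr2 normr_id ler_wpM2l.
  rewrite wintD// lerD2l wintZ// mulrC ler_wpM2r ?invr_ge0 ?(ltW M0)//.
  exact: wint_residual_bound.
apply/cvgr0Pnorm_lt => e e0.
pose M := 2 * (K + 1) / e.
have M0 : 0 < M by rewrite divr_gt0// mulr_gt0// ltr_wpDl.
have e20 : 0 < e / 2 by rewrite divr_gt0.
have /cvgr0Pnorm_lt/(_ _ e20) h0 := trunc0 _ M0; near=> N.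
have : `|wint (fun t => Num.min `|residual N t| M)| < e / 2 by near: N.
rewrite !ger0_norm; last 2 first.
- by apply: wint_ge0 => t _; rewrite ?le_min ?normr_ge0 ?(ltW M0).
- by apply: wint_ge0 => t _; rewrite ?le_min ?normr_ge0 ?(ltW M0).
move=> h; apply: (le_lt_trans (key M N M0)).
have KM : K / M <= e / 2.
  rewrite ler_pdivrMr// /M; have -> : e / 2 * (2 * (K + 1) / e) = K + 1.
    by field; rewrite gt_eqF.
  by rewrite lerDl.
by lra.
Unshelve. all: by end_near. Qed.

End Bessel.

(** * Countably many discontinuities, and measurability *)

Section RegulatedFunctions.
Context {R : realType}.
Implicit Types (a b : R) (f : R -> R).

(* Each point where the oscillation is at least [e] is isolated from the
   right, hence is the left end of an interval free of such points; a rational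
   number in that interval identifies the point. *)
Lemma HBV_countable_discontinuities a b f : HBV a b f -> exists2 D : set R,
  countable D & forall t, a < t < b -> ~ D t -> {for t, continuous f}.
Proof.
move=> hf.
pose E m := [set t | a < t < b /\
  ~ \forall s \near t, `|f t - f s| < (m.+1%:R)^-1].
exists (\bigcup_m E m).
  apply: bigcup_countable => // m _; apply/countable_injP.
  have hq t : exists q : rat, E m t -> t < ratr q /\
      {in `]t, ratr q[, forall t', ~ E m t'}.
    have [Et|nE] := pselect (E m t); last by exists 0.
    have [/andP[ta tb] _] := Et.
    have hft : HBV t b f by apply: HBV_sub hf => //; exact: ltW.
    have m0 : 0 < m.+1%:R^-1 :> R by rewrite invr_gt0.
    have [d /andP[td db] hd] := HBV_right_cauchy tb hft m0.
    have [q] := rat_in_itvoo td; rewrite in_itv/= => /andP[tq qd].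
    exists q => _; split => // t'; rewrite in_itv/= => /andP[t1 t2] [_]; apply.
    near=> s; apply: hd; rewrite in_itv/=; first by rewrite t1 (lt_trans t2).
    apply/andP; split; near: s; first exact: lt_nbhsr.
    by apply: lt_nbhsl; rewrite (lt_trans t2).
  have [q hq'] := choice hq.
  exists (pickle \o q) => t t'; rewrite !inE => Et Et' /=.
  move=> /(pcan_inj pickleK) qq.
  wlog tt' : t t' Et Et' qq / t < t'.
    move=> h; case: (ltgtP t t') => // tt'; first exact: h.
    by apply/esym; exact: h.
  have [_ h1] := hq' _ Et; have [h2 _] := hq' _ Et'.
  have := h1 t'; rewrite in_itv/= tt' qq h2 => /(_ isT) h3; case: (h3 Et').
move=> t tab nD; apply/cvgrPdist_lt => e e0.
have [m me] : exists m, (m.+1%:R)^-1 < e :> R.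
  exists (Num.bound e^-1); rewrite invf_plt ?posrE//.
  by rewrite (lt_le_trans (archi_boundP _))// ?invr_ge0 ?(ltW e0)// ler_nat.
have : ~ E m t by move=> Et; apply: nD; exists m.
move=> /not_andP[//|/contrapT]; apply: filterS => s hs.
exact: lt_trans hs me.
Unshelve. all: by end_near. Qed.

(** The preimage of an open ray exceeds its interior only by points of [D], and every subset of a
    countable set is Borel. *)
Lemma measurable_fun_continuous_except a b f (D : set R) : countable D ->
  (forall t, a < t < b -> ~ D t -> {for t, continuous f}) ->
  measurable_fun (`]a, b[%classic : set (measurableTypeR R)) f.
Proof.
move=> cD cf; apply: (measurability _ (RGenOInfty.measurableE R)).
move=> /= _ [_ [r ->]] <-.
have cm (A : set R) : A `<=` D -> measurable (A : set (measurableTypeR R)).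
  move=> AD; apply: countable_measurable => //.
  exact: sub_countable (subset_card_le AD) cD.
set U := f @^-1` _.
have -> : `]a, b[%classic `&` U =
    (`]a, b[%classic `&` interior U) `|` (`]a, b[%classic `&` (U `&` D)).
  rewrite -setIUr; apply/seteqP; split => t [tI tU]; split => //.
    have [Dt|nD] := pselect (D t); first by right.
    left; have tab : a < t < b by move: tI; rewrite /= in_itv.
    by apply: (cf t tab nD); apply: open_nbhs_nbhs; split.
  by case: tU => [/interior_subset//|[]].
apply: measurableU.
  apply: measurableI => //; apply: open_measurable; exact: open_interior.
by apply: cm => t [_ []].
Qed.

Lemma HBV_bounded_measurable f : HBV (-1) 1 f -> bounded_measurable f.
Proof.
move=> hf; have [C C0 hC] := HBV_bounded hf; split.
  have [D cD hD] := HBV_countable_discontinuities hf.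
  apply: (@measurable_fun_itv_cc R (-1) 1 false true).
  exact: measurable_fun_continuous_except cD hD.
exists (C + `|f 1|) => t ht.
have := hC t 1 ht; rewrite in_itv/= lexx andbT => /(_ _) h.
by rewrite -lerBlDr (le_trans (lerB_dist _ _))// h; lra.
Qed.

End RegulatedFunctions.

(** * Limits of sequences and changes on countable sets *)

Section Limits.
Context {R : realType}.

Lemma cvgn_sub (f g : nat -> R) (l m : R) :
  f n @[n --> \oo] --> l -> g n @[n --> \oo] --> m ->
  f n - g n @[n --> \oo] --> l - m.
Proof. by move=> hf hg; apply: cvgB. Qed.

Lemma cvgn_mull (c : R) (f : nat -> R) (l : R) :
  f n @[n --> \oo] --> l -> c * f n @[n --> \oo] --> c * l.
Proof. by move=> hf; apply: cvgMr. Qed.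

Lemma nondecreasing_cvg0_le (U : nat -> R) N n :
  (forall m, (N <= m)%N -> U m <= U m.+1) -> U n @[n --> \oo] --> (0 : R) ->
  (N <= n)%N -> U n <= 0.
Proof.
move=> hU cU Nn; apply: (ler_cvg_to (cvg_cst (U n)) cU).
near=> m; have nm : (n <= m)%N by near: m; exact: nbhs_infty_ge.
rewrite -(subnKC nm); elim: (m - n)%N => [|k IH]; first by rewrite addn0.
by rewrite addnS (le_trans IH)// hU// (leq_trans Nn)// leq_addr.
Unshelve. all: by end_near. Qed.

Lemma cvgn_mul (f g : nat -> R) (l m : R) :
  f n @[n --> \oo] --> l -> g n @[n --> \oo] --> m ->
  f n * g n @[n --> \oo] --> l * m.
Proof. by move=> hf hg; apply: cvgM. Qed.

Lemma cvg_near_eq_fun (f g : nat -> R) (l : R) :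
  (\forall n \near \oo, f n = g n) ->
  f n @[n --> \oo] --> l -> g n @[n --> \oo] --> l.
Proof.
move=> fg; apply: cvg_trans; apply: near_eq_cvg.
by apply: filterS fg => n ->.
Qed.

(** The 0/0 form of the Stolz-Cesaro theorem, for the comparison sequence 1 / (m + 1), whose
    decrements are 1 / ((m + 1) (m + 2)). *)
Lemma stolz (Y : nat -> R) (L : R) : Y m @[m --> \oo] --> (0 : R) ->
  m.+1%:R * m.+2%:R * (Y m - Y m.+1) @[m --> \oo] --> L ->
  m.+1%:R * Y m @[m --> \oo] --> L.
Proof.
move=> Y0 dY.
have n0 (n : nat) : n.+1%:R != 0 :> R by rewrite pnatr_eq0.
have n0' (n : nat) : 0 < n.+1%:R :> R by rewrite ltr0n.
have c0 (c : R) : c / m.+1%:R @[m --> \oo] --> (0 : R).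
  by rewrite -(mulr0 c); apply: cvgMr; exact: cvg_harmonic.
apply/cvgrPdist_le => e e0.
move/cvgrPdist_le : dY => /(_ _ e0) [N _ hN].
(* From rank [N] on, [U] is nondecreasing with limit 0, hence nonpositive. The signs s = 1 and s =
   -1 give the two halves of the absolute value. *)
have key s : `|s| <= 1 -> s ^+ 2 = 1 -> forall n, (N <= n)%N ->
    s * (Y n - L / n.+1%:R) - e / n.+1%:R <= 0.
  move=> _ s2 n Nn.
  pose U n := s * (Y n - L / n.+1%:R) - e / n.+1%:R.
  apply: (@nondecreasing_cvg0_le U N n) => // [m Nm|]; last first.
    rewrite -[X in _ --> X](subrr 0); apply: cvgn_sub; last exact: c0.
    rewrite -[X in _ --> X](mulr0 s); apply: cvgn_mull.
    by rewrite -[X in _ --> X](subrr 0); apply: cvgn_sub => //; exact: c0.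
  have hm := hN m Nm; rewrite -subr_ge0.
  have -> : U m.+1 - U m = (e + s * (L - m.+1%:R * m.+2%:R * (Y m - Y m.+1))) /
      (m.+1%:R * m.+2%:R).
    rewrite /U; have := n0 m; have := n0 m.+1.
    by rewrite -(natr1 m.+1) -(natr1 m) => h1 h2; field; rewrite h1 h2.
  rewrite divr_ge0 ?mulr_ge0//.
  set D := L - _ in hm *.
  have sD : `|s * D| <= e.
    rewrite normrM; have -> : `|s| = 1 by apply/eqP; rewrite -sqrp_eq1// -normrX s2 normr1.
    by rewrite mul1r.
  by move: sD; rewrite ler_norml => /andP[h _]; lra.
exists N => // m /= Nm.
have h1 := key 1 _ _ m Nm; have h2 := key (-1) _ _ m Nm.
rewrite normrN normr1 in h2; rewrite normr1 in h1.
have {}h1 := h1 (lexx _) (expr1n _ _).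
have {}h2 : -1 * (Y m - L / m.+1%:R) - e / m.+1%:R <= 0.
  by apply: h2 => //; rewrite sqrrN expr1n.
have -> : L - m.+1%:R * Y m = - (m.+1%:R * (Y m - L / m.+1%:R)).
  by rewrite mulrBr [_ * (L / _)]mulrC divfK// opprB.
have E : e = m.+1%:R * (e / m.+1%:R) by rewrite mulrC divfK.
rewrite normrN normrM ger0_norm// {}E ler_wpM2l// ler_norml.
move: h1 h2; set A := Y m - _; set B := e / _ => h1 h2.
by apply/andP; split; lra.
Qed.

Lemma cos_cvg_at_right (th : R) : 0 < th < pi ->
  cos t @[t --> th^'+] --> (cos th)^'-.
Proof.
move=> /andP[th0 thpi] A hA; suff : \forall t \near th^'+, A (cos t) by [].
have h : \forall t \near th, cos t < cos th -> A (cos t).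
  exact: (@continuous_cos R th _ hA).
rewrite near_withinE; near=> t => tth.
have tpi : t < pi by near: t; exact: lt_nbhsl.
have : cos t < cos th -> A (cos t) by near: t.
apply; rewrite ltr_cos// in_itv/= ?(ltW th0) ?(ltW thpi)//.
by rewrite (ltW tpi) ltW// (lt_trans th0).
Unshelve. all: by end_near. Qed.

Lemma cos_cvg_at_left (th : R) : 0 < th < pi ->
  cos t @[t --> th^'-] --> (cos th)^'+.
Proof.
move=> /andP[th0 thpi] A hA; suff : \forall t \near th^'-, A (cos t) by [].
have h : \forall t \near th, cos th < cos t -> A (cos t).
  exact: (@continuous_cos R th _ hA).
rewrite near_withinE; near=> t => tth.
have tpi : 0 < t by near: t; exact: lt_nbhsr.
have : cos th < cos t -> A (cos t) by near: t.
apply; rewrite ltr_cos// in_itv/= ?(ltW th0) ?(ltW thpi)//.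
by rewrite (ltW tpi) ltW// (lt_trans _ thpi).
Unshelve. all: by end_near. Qed.

(** Measurability is Borel here, so a change on an arbitrary null set could destroy it; on a
    countable set it cannot. *)
Lemma measurable_fun_eq_except (I D : set (measurableTypeR R)) (g h : R -> R) :
  measurable I -> countable D -> (forall t, I t -> ~ D t -> h t = g t) ->
  measurable_fun I g -> measurable_fun I h.
Proof.
move=> mI cD hg mg _ Y mY.
have cm (A : set R) : A `<=` D -> measurable (A : set (measurableTypeR R)).
  move=> AD; apply: countable_measurable => //.
  exact: sub_countable (subset_card_le AD) cD.
have -> : I `&` h @^-1` Y =
    ((I `&` g @^-1` Y) `\` D) `|` (I `&` h @^-1` Y `&` D).
  apply/seteqP; split => t /=.
    move=> [It ht]; have [Dt|nD] := pselect (D t); first by right.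
    by left; rewrite -hg.
  by case=> [[[It ht] nD]|[]//]; rewrite hg.
apply: measurableU; last by apply: cm => t [].
by apply: measurableD; [exact: mg|exact: cm].
Qed.

Lemma is_derive_sum_sin (c : nat -> R) n (t : R) :
  is_derive t 1 (fun t => \sum_(i < n) c i * sin (i.+1%:R * t))
    (\sum_(i < n) c i * (i.+1%:R * cos (i.+1%:R * t))).
Proof.
have -> : (fun t => \sum_(i < n) c i * sin (i.+1%:R * t)) =
    \sum_(i < n) (fun t => c i * sin (i.+1%:R * t)) :> (R -> R).
  by apply/funext => u; rewrite fct_sumE.
apply: (@is_derive_sum R R R n (fun i t => c i * sin (i.+1%:R * t)) t 1
  (fun i => c i * (i.+1%:R * cos (i.+1%:R * t)))) => i; apply: is_derive_eq.
by rewrite /GRing.scale/= mulr1; ring.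
Qed.

End Limits.

(** * Moments of [f] against the kernels *)

Section ChebyshevSeries.
Context {R : realType}.
Notation mu := (@lebesgue_measure R).
Notation w := (@chebyshev_weight R).
Context (iw : mu.-integrable `[-1, 1] (EFin \o w)).
Context (f : R -> R) (hf : HBV (-1) 1 f).

Let bf : bounded_measurable f := HBV_bounded_measurable hf.

Definition moment p := wint (fun t => f t * p.[t]).

Let bfp p : bounded_measurable (fun t => f t * p.[t]).
Proof. by apply: bounded_measurableM => //; exact: bounded_measurable_poly. Qed.

Lemma momentD p q : moment (p + q) = moment p + moment q.
Proof.
rewrite /moment -wintD//; apply: eq_wint => t _.
by rewrite hornerD mulrDr.
Qed.

Lemma momentZ c p : moment (c *: p) = c * moment p.
Proof.
rewrite /moment -wintZ//; apply: eq_wint => t _.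
by rewrite hornerZ mulrCA.
Qed.

Lemma moment_sum n (c : nat -> R) (Q : nat -> {poly R}) :
  moment (\sum_(i < n) c i *: Q i) = \sum_(i < n) c i * moment (Q i).
Proof.
have m0 : moment 0 = 0 by rewrite -[0](scale0r (1 : {poly R})) momentZ mul0r.
by rewrite (big_morph _ momentD m0); apply: eq_bigr => i _; rewrite momentZ.
Qed.

Lemma moment_localization th (q : nat -> {poly R}) (k H : nat -> R -> R) (fp fm : R) :
  0 < th < pi -> localized_kernel th k H ->
  (forall n (t : R), k n t = (q n).[cos t]) ->
  (forall n (t : R), is_derive t 1 (H n) (k n t)) ->
  f y @[y --> (cos th)^'+] --> fp -> f y @[y --> (cos th)^'-] --> fm ->
  moment (q n) - (fm * (H n pi - H n th) + fp * (H n th - H n 0))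
    @[n --> \oo] --> (0 : R).
Proof.
move=> hth hk kE dH cp cm.
have hg : HBV 0 pi (f \o cos).
  apply: HBV_antitone hf => [x y hx hy|x _]; first by rewrite ltr_cos.
  by rewrite in_itv/= cos_geN1 cos_le1.
have := localization hth hg hk (fun n => primitive_pair_weighted iw bf (kE n) (dH n)).
(* [cos] decreases, so the right limit of [f \o cos] at [th] is the left limit [fm]. The weighted
   primitive is 0 at pi, where the interval is the point -1, and minus the whole moment at 0. *)
move=> /(_ fm fp) h; apply: cvg_eq_fun (h _ _) => [n||].
- rewrite cospi cos0 set_itv1 Rintegral_set1 oppr0 add0r opprK.
  by rewrite /moment /wint.
- exact: cvg_comp (cos_cvg_at_right hth) cm.
- exact: cvg_comp (cos_cvg_at_left hth) cp.
Qed.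

Definition dirichlet_poly th n : {poly R} :=
  1 + 2 *: \sum_(i < n) cos (i.+1%:R * th) *: cheb i.+1.

Definition jump_poly th n : {poly R} :=
  n%:R^-1 *: \sum_(i < n) (i.+1%:R * sin (i.+1%:R * th)) *: cheb i.+1.

Lemma dirichlet_polyE th n t : dirichlet_kernel th n t = (dirichlet_poly th n).[cos t].
Proof.
rewrite /dirichlet_poly hornerD hornerC hornerZ horner_sum; congr (1 + 2 * _).
by apply: eq_bigr => i _; rewrite hornerZ horner_cheb.
Qed.

Lemma jump_polyE th n t : jump_kernel th n t = (jump_poly th n).[cos t].
Proof.
rewrite /jump_poly hornerZ horner_sum mulrC; congr (_ * _).
by apply: eq_bigr => i _; rewrite hornerZ horner_cheb.
Qed.

Lemma is_derive_dirichlet_primitive th n (t : R) :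
  is_derive t 1 (dirichlet_primitive th n) (dirichlet_kernel th n t).
Proof.
have h := is_derive_sum_sin (fun i => cos (i.+1%:R * th) / i.+1%:R) n t.
have -> : dirichlet_primitive th n = (fun t => t + 2 * \sum_(i < n)
    cos (i.+1%:R * th) / i.+1%:R * sin (i.+1%:R * t)).
  apply/funext => u; rewrite /dirichlet_primitive; congr (_ + 2 * _).
  by apply: eq_bigr => i _; rewrite mulrAC mulrA.
apply: is_derive_eq; rewrite /GRing.scale/=.
rewrite /dirichlet_kernel; congr (1 + 2 * _); apply: eq_bigr => i _.
by rewrite mulrA divfK.
Qed.

Lemma is_derive_jump_primitive th n (t : R) :
  is_derive t 1 (jump_primitive th n) (jump_kernel th n t).
Proof.
have h := is_derive_sum_sin (fun i => sin (i.+1%:R * th)) n t.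
rewrite /jump_primitive; apply: is_derive_eq.
rewrite /GRing.scale/= mulr0 add0r mulrC /jump_kernel; congr (_ / _).
by apply: eq_bigr => i _; ring.
Qed.

(** The two one-sided limits agree, so only the total mass pi of the kernel matters, not its split
    at [th]. *)
Lemma dirichlet_moment_cvg th : 0 < th < pi -> {for cos th, continuous f} ->
  moment (dirichlet_poly th n) @[n --> \oo] --> pi * f (cos th).
Proof.
move=> hth cf.
have := moment_localization hth (localized_dirichlet hth) (dirichlet_polyE th)
  (is_derive_dirichlet_primitive th) (cvg_at_right_filter cf) (cvg_at_left_filter cf).
move=> h; rewrite -[X in _ --> X]add0r.
apply: (@cvg_eq_fun _ (fun n => moment (dirichlet_poly th n) -
    (f (cos th) * (dirichlet_primitive th n pi - dirichlet_primitive th n th) +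
     f (cos th) * (dirichlet_primitive th n th - dirichlet_primitive th n 0)) +
    pi * f (cos th))) => [n|]; last first.
  by apply: cvgn_add => //; exact: cvg_cst.
have -> : dirichlet_primitive th n 0 = 0.
  rewrite /dirichlet_primitive big1 ?mulr0 ?addr0// => i _.
  by rewrite mulr0 sin0 mul0r mulr0.
have E : dirichlet_primitive th n pi = pi.
  rewrite /dirichlet_primitive big1 ?mulr0 ?addr0// => i _.
  by rewrite sin_natpi mul0r mulr0.
by rewrite E /=; ring.
Qed.

(** This is the mean of sin^2 (k th) over k <= n. Its deviation from 1 / 2 is a cosine sum at 2 *
    th, bounded because sin th > 0, divided by 2 n. *)
Lemma jump_primitive_diag_cvg th : 0 < th < pi ->
  jump_primitive th n th @[n --> \oo] --> (2^-1 : R).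
Proof.
move=> hth; have s0 := sin_gt0_pi hth.
have e n : (0 < n)%N -> jump_primitive th n th - 2^-1 =
    - (2 * n%:R)^-1 * \sum_(i < n) cos (i.+1%:R * (2 * th)).
  move=> n0; rewrite jump_primitiveE subrr.
  under eq_bigr => i _ do rewrite mulr0 cos0.
  rewrite sumr_const card_ord -[1 *+ n]/(n%:R).
  have -> : th + th = 2 * th by ring.
  by field; rewrite pnatr_eq0 -lt0n.
apply/cvgrPdist_le => e' e0; near=> n.
have n0 : (0 < n)%N by near: n; exact: nbhs_infty_gt.
have n0' : 0 < n%:R :> R by rewrite ltr0n.
rewrite distrC e// normrM normrN normfV [`|2 * _|]ger0_norm; last by rewrite mulr_ge0.
have := ler_sum_cos n (2 * th).
have -> : 2 * th / 2 = th by field.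
rewrite (gtr0_norm s0) -ler_pdivlMr// mul1r => h.
apply: (le_trans (ler_wpM2l _ h)); first by rewrite invr_ge0 mulr_ge0.
rewrite -invfM invf_ple ?posrE ?mulr_gt0//.
have : (e' * (2 * sin th))^-1 <= n%:R by near: n; exact: nbhs_infty_ger.
rewrite invfM ler_pdivrMr ?mulr_gt0// => h2.
by rewrite (le_trans h2)// le_eqVlt; apply/orP; left; apply/eqP; ring.
Unshelve. all: by end_near. Qed.

Lemma jump_moment_cvg th : 0 < th < pi ->
  moment (jump_poly th n) @[n --> \oo] --> jump f (cos th) / 2.
Proof.
move=> hth; have /andP[x1 x2] := cos_in_oo hth.
have cp : cvg (f y @[y --> (cos th)^'+]).
  by apply: HBV_cvg_right hf; rewrite ltW.
have cm : cvg (f y @[y --> (cos th)^'-]).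
  by apply: HBV_cvg_left hf; rewrite ltW// x1.
have := moment_localization hth (localized_jump hth) (jump_polyE th)
  (is_derive_jump_primitive th) cp cm.
move=> h; rewrite /jump.
set fp := lim (f y @[y --> (cos th)^'+]) in h *.
set fm := lim (f y @[y --> (cos th)^'-]) in h *.
have c := cvgn_mull (c := fp - fm) (jump_primitive_diag_cvg hth).
have := cvgn_add h c; rewrite add0r; apply: cvg_eq_fun => n.
have -> : jump_primitive th n 0 = 0.
  by rewrite /jump_primitive big1 ?mul0r// => i _; rewrite mulr0 sin0 mulr0.
have -> : jump_primitive th n pi = 0.
  by rewrite /jump_primitive big1 ?mul0r// => i _; rewrite sin_natpi mulr0.
by rewrite /=; ring.
Qed.

End ChebyshevSeries.

(** * Primitives of the tails *)

Section TailPrimitive.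
Context {R : realType}.
Notation mu := (@lebesgue_measure R).
Notation w := (@chebyshev_weight R).
Context (P : nat -> {poly R}) (hP : chebyshev_orthonormal P).
Context (f : R -> R) (hf : HBV (-1) 1 f).

Let iw := weight_integrable hP.
Let bf := HBV_bounded_measurable hf.
Local Notation res := (residual P f).

Let oP n m : wpoly (P n * P m) = (n == m)%:R.
Proof.
case: hP => _ _ <-; rewrite /wpoly /wint; apply: eq_Rintegral => t _.
by rewrite hornerM.
Qed.

Lemma coefE k : fourier_chebyshev_coef P f k = moment f (P k).
Proof. by []. Qed.

Lemma coef_horner k t : fourier_chebyshev_coef P f k * (P k).[t] =
  cheb_norm2 k * moment f (cheb k) * (cheb k).[t].
Proof.
have [al hal al2] := orthonormal_chebE iw hP.
by rewrite coefE hal momentZ// hornerZ -al2; ring.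
Qed.

Lemma residual_cvg0 t : -1 < t < 1 -> {for t, continuous f} ->
  res N t @[N --> \oo] --> (0 : R).
Proof.
move=> ht cf; have pi0 := pi_gt0 R.
have tI : t \in `[-1, 1] by rewrite in_itv/=; case/andP: ht => /ltW-> /ltW->.
have [t1 t2] : -1 <= t < 1 /\ -1 < t <= 1 by case/andP: ht => h1 h2; rewrite h1 h2 !ltW.
have hth : 0 < acos t < pi by rewrite acos_gt0 ?acos_ltpi.
have tE := acosK tI.
(* [dirichlet_poly] of index n contains the n + 1 modes 0, ..., n, hence the comparison with [res]
   at n + 1. *)
rewrite -(cvg_shiftS (fun N => res N t)).
have := dirichlet_moment_cvg iw hf hth; rewrite tE => /(_ cf) h.
have h0 : (fun=> f t) n @[n --> \oo] --> f t by exact: cvg_cst.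
have := cvgn_add h0 (cvgn_mull (c := - pi^-1) h).
have -> : f t + - pi^-1 * (pi * f t) = 0.
  by rewrite mulNr mulKf ?subrr// gt_eqF.
apply: cvg_eq_fun => n; rewrite /residual mulNr; congr (_ - _).
rewrite big_ord_recl coef_horner /= hornerC mulr1.
rewrite /dirichlet_poly momentD// momentZ//.
rewrite (moment_sum iw hf n (fun i => cos (i.+1%:R * acos t)) (fun i => cheb i.+1)).
rewrite mulrDr; congr (_ + _); rewrite mulrA mulr_sumr; apply: eq_bigr => i _.
by rewrite coef_horner -{2}tE horner_cheb /=; ring.
Qed.

Lemma exceptional_set : exists2 D : set R, countable D &
  forall t, -1 <= t <= 1 -> ~ D t -> res N t @[N --> \oo] --> (0 : R).
Proof.
have [D cD hD] := HBV_countable_discontinuities hf.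
(* Convergence is known at continuity points of the open interval only, so both endpoints are added
   to the discontinuities. *)
exists (\bigcup_(i : bool) if i then D else [set -1; 1]).
  apply: bigcup_countable => // -[] _ //.
  by apply: finite_set_countable; exact: finite_set2.
move=> t /andP[t1 t2] nD.
have ht : -1 < t < 1.
  by rewrite !lt_neqAle t1 t2 !andbT; apply/andP; split;
    apply/eqP => tE; apply: nD; exists false => //; [left|right].
by apply: residual_cvg0 => //; apply: hD => // Dt; apply: nD; exists true.
Qed.

Lemma chebyshev_tailE n t : res N t @[N --> \oo] --> (0 : R) ->
  chebyshev_tail P f n t = res n t.
Proof.
move=> h; apply/cvg_lim => //.
have h0 : (fun=> res n t) N @[N --> \oo] --> res n t by exact: cvg_cst.
have c0 := cvgn_sub h0 h; rewrite subr0 in c0.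
apply: cvg_trans c0; apply: near_eq_cvg; near=> N.
have nN : (n <= N)%N by near: N; exact: nbhs_infty_ge.
rewrite /residual -!(big_mkord xpredT (fun k => fourier_chebyshev_coef P f k * (P k).[t])).
have := @big_cat_nat _ _ _ n 0%N N xpredT
  (fun k => fourier_chebyshev_coef P f k * (P k).[t]) (leq0n n) nN.
by move=> -> /=; ring.
Unshelve. all: by end_near. Qed.

Lemma integrable_unweighted u x : -1 <= x <= 1 -> bounded_measurable u ->
  mu.-integrable `[-1, x] (EFin \o u).
Proof.
move=> /andP[x1 x2] [mu' [C hC]].
have sub : `[-1, x]%classic `<=` `[-1, 1]%classic.
  by move=> t /=; rewrite !in_itv/= => /andP[-> h]; exact: le_trans h x2.
apply: measurable_bounded_integrable => //.
- by rewrite /= lebesgue_measure_itv/= lte_fin; case: ifP => _; rewrite ?ltry// -EFinB ltry.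
- exact: measurable_funS sub mu'.
- exists C; split; first exact: num_real.
  move=> M CM t /= /sub ht; apply: le_trans (hC _ ht) (ltW CM).
Qed.

(** On [D] the series may diverge, and the tail is then a default value of [limn]. As [D] is
    countable, neither measurability nor the integral is affected. *)
Lemma tail_primitiveE n x : -1 <= x <= 1 ->
  chebyshev_tail_primitive P f n x = \int[mu]_(t in `[-1, x]) res n t.
Proof.
move=> hx; have [D cD hD] := exceptional_set.
have /andP[x1 x2] := hx.
have ir := integrable_unweighted hx (bounded_measurable_residual P bf n).
have mr : measurable_fun (`[-1, x]%classic : set (measurableTypeR R)) (res n).
  by case/integrableP : ir => /measurable_EFinP.
have hE t : `[-1, x]%classic t -> ~ D t -> chebyshev_tail P f n t = res n t.
  rewrite /= in_itv/= => /andP[t1 t2] nD; apply: chebyshev_tailE; apply: hD => //.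
  by rewrite t1 (le_trans t2).
have mt : measurable_fun (`[-1, x]%classic : set (measurableTypeR R))
    (chebyshev_tail P f n).
  by apply: (measurable_fun_eq_except _ cD hE mr).
rewrite /chebyshev_tail_primitive /Rintegral; congr fine.
apply: ae_eq_integral => //; [exact/measurable_EFinP|exact/measurable_EFinP|].
exists D; split.
- exact: countable_measurable.
- exact: countable_lebesgue_measure0.
move=> t /= h; apply: contrapT => nD; apply: h => tI.
by rewrite hE.
Qed.

(** The weight is at least 1 on (-1, 1), so the plain integral of the absolute residual is at most
    the weighted one over [-1, 1], which tends to 0. *)
Lemma tail_primitive_cvg0 x : -1 < x < 1 ->
  chebyshev_tail_primitive P f n x @[n --> \oo] --> (0 : R).
Proof.
move=> /andP[x1 x2]; have hx : -1 <= x <= 1 by rewrite !ltW.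
have [D cD hD] := exceptional_set.
have h := wint_norm_residual_cvg0 iw oP bf cD hD.
apply/norm_cvg0P; apply: (@squeeze_cvgr _ _ _ _ (fun=> 0)
  (fun N => wint (fun t => `|res N t|))) => //; last exact: cvg_cst.
apply: nearW => n; rewrite normr_ge0 /= tail_primitiveE//.
have br := bounded_measurable_residual P bf n.
have ir := integrable_unweighted hx br.
have bn := bounded_measurable_norm br.
have inr := integrable_unweighted hx bn.
have iwn := integrable_weighted iw bn.
apply: (le_trans (le_normr_Rintegral _ _)) => //.
have sub : `]-1, x] `<=` `[-1, x].
  by move=> t /=; rewrite !in_itv/= => /andP[/ltW-> ->].
have sub' : `[-1, x] `<=` `[-1, 1].
  by move=> t /=; rewrite !in_itv/= => /andP[-> h']; rewrite (le_trans h')// ltW.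
have iwn' : mu.-integrable `[-1, x] (EFin \o (fun t => `|res n t| * w t)).
  exact: integrableS iwn.
have i1 : mu.-integrable `]-1, x] (EFin \o (fun t => `|res n t|)) by exact: integrableS inr.
have i2 : mu.-integrable `]-1, x] (EFin \o (fun t => `|res n t| * w t)).
  exact: integrableS iwn'.
apply: (@le_trans _ _ (\int[mu]_(t in `[-1, x]) (`|res n t| * w t))).
  (* The point -1 is removed first: there the weight has the value 0, and the comparison with 1
     would fail. *)
  rewrite -Rintegral_itv_obnd_cbnd// -[leRHS]Rintegral_itv_obnd_cbnd//.
  apply: le_Rintegral => // t; rewrite /= in_itv/= => /andP[t1 t2].
  rewrite -[leLHS]mulr1 ler_wpM2l// weight_ge1// t1 /=.
  exact: le_lt_trans t2 x2.
rewrite /wint -subr_ge0 Rintegral_itvB ?bnd_simp//; [|exact: ltW|exact: ltW].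
by apply: Rintegral_ge0 => t _; rewrite mulr_ge0 ?weight_ge0.
Qed.

(** The coefficient of [cheb k] in the series, that is the Fourier cosine coefficient c_k of
    [f \o cos]. *)
Definition cheb_moment k : R := cheb_norm2 k * moment f (cheb k).

Lemma cheb_moment_cvg0 : cheb_moment n @[n --> \oo] --> (0 : R).
Proof.
have [al hal al2] := orthonormal_chebE iw hP.
have h := fourier_chebyshev_coef_cvg0 iw oP bf.
have {}h : `|fourier_chebyshev_coef P f n| @[n --> \oo] --> (0 : R).
  by apply/norm_cvg0P.
apply/norm_cvg0P; apply: (@squeeze_cvgr _ _ _ _ (fun=> 0)
  (fun n => `|fourier_chebyshev_coef P f n|)) => //; last exact: cvg_cst.
apply: nearW => n; rewrite normr_ge0 /=.
have -> : cheb_moment n = al n * fourier_chebyshev_coef P f n.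
  by rewrite coefE hal momentZ// /cheb_moment -al2; ring.
(* The normalising factor is at most 1 in absolute value: its square is 1 / pi or 2 / pi, and pi >=
   2. *)
rewrite normrM ler_piMl// -(@expr_le1 _ 2)// -normrX al2.
have := pi_ge2 R => pi2; have pi0 := pi_gt0 R.
case: n => [|n] /=; rewrite ger0_norm ?invr_ge0 ?divr_ge0 ?(ltW pi0)//.
  by rewrite invf_le1//; lra.
by rewrite ler_pdivrMr// mul1r.
Qed.

Lemma tail_primitive_step n x : -1 <= x <= 1 ->
  chebyshev_tail_primitive P f n x - chebyshev_tail_primitive P f n.+1 x =
  cheb_moment n * \int[mu]_(t in `[-1, x]) (cheb n).[t].
Proof.
move=> hx; rewrite !tail_primitiveE//.
have ir m := integrable_unweighted hx (bounded_measurable_residual P bf m).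
have ic := integrable_unweighted hx (bounded_measurable_poly (cheb n)).
rewrite -RintegralB// -RintegralZl//; apply: eq_Rintegral => t _.
by rewrite residualS coef_horner /cheb_moment; ring.
Qed.

End TailPrimitive.

(** * From averaged coefficients to the jump *)

Section JumpDetection.
Context {R : realType}.
Notation mu := (@lebesgue_measure R).

Lemma integral_cheb n (th : R) : (1 < n)%N -> 0 <= th <= pi ->
  (n%:R ^+ 2 - 1) * \int[mu]_(t in `[-1, cos th]) (cheb n).[t] =
  - cos (n%:R * pi) - n%:R * (sin th * sin (n%:R * th)) - cos th * cos (n%:R * th).
Proof.
move=> n1 hth; have N1 : 1 < n%:R :> R by rewrite ltr1n.
have c0 : n%:R ^+ 2 - 1 != 0 :> R.
  by rewrite gt_eqF// subr_gt0 exprn_egt1.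
(* On differentiating, the two terms n cos t sin (n t) cancel and (n^2 - 1) sin t cos (n t) remains;
   n > 1 keeps the divisor nonzero. *)
pose S (t : R) := (n%:R ^+ 2 - 1)^-1 *
  (n%:R * (sin t * sin (n%:R * t)) + cos t * cos (n%:R * t)).
have dS (t : R) : is_derive t 1 S ((cheb n).[cos t] * sin t).
  rewrite horner_cheb /S; apply: is_derive_eq; rewrite /GRing.scale/=.
  by field.
have cS : continuous S.
  move=> t; apply: differentiable_continuous; apply/derivable1_diffP.
  by have [] := dS t.
have i1 : mu.-integrable `[-1, 1] (EFin \o horner (cheb n)).
  by apply: (integrable_unweighted _ (bounded_measurable_poly _)); apply/andP; split; lra.
rewrite (integral_cos_substitution i1 (fun t _ => @continuous_horner _ _ t)
  (fun t _ => dS t) cS hth).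
rewrite /S mulrBr !mulVKf// sinpi cospi.
by ring.
Qed.

Lemma HBV_tail_detects_jump (P : nat -> {poly R}) (f : R -> R) x :
  chebyshev_orthonormal P -> HBV (-1) 1 f -> -1 < x < 1 ->
  tail_detects_jump P f x.
Proof.
move=> hP hf hx; have /andP[x1 x2] := hx; have pi0 := pi_gt0 R.
have iw := weight_integrable hP.
have xI : x \in `[-1, 1] by rewrite in_itv/= !ltW.
have hx' : -1 <= x <= 1 by rewrite !ltW.
pose th := acos x.
have thE : cos th = x by exact: acosK.
have hth : 0 < th < pi by rewrite acos_gt0 ?acos_ltpi ?x1 ?x2 ?ltW.
have hth' : 0 <= th <= pi by case/andP: hth => /ltW-> /ltW->.
pose s := sin th.
have sE : s = Num.sqrt (1 - x ^+ 2) by rewrite /s sin_acos.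
pose Q n := chebyshev_tail_primitive P f n x.
pose ka n := cheb_moment f n.
pose b i := ka i.+1 * (i.+1%:R * sin (i.+1%:R * th)).
pose sg m := \sum_(i < m) b i.
pose l := jump f x / pi.
have Q0 : Q n @[n --> \oo] --> (0 : R) by exact: tail_primitive_cvg0.
have ka0 : ka n @[n --> \oo] --> (0 : R) by exact: (cheb_moment_cvg0 hP hf).
have sg_cvg : sg m / m%:R @[m --> \oo] --> l.
  (* Only positive degrees occur in [jump_poly], and there [cheb_norm2] is 2 / pi. *)
  have h := cvgn_mull (c := 2 / pi) (jump_moment_cvg iw hf hth).
  have -> : l = 2 / pi * (jump f x / 2).
    by rewrite [RHS]mulrC mulrA divfK.

  rewrite thE in h; apply: cvg_eq_fun h => m.
  rewrite /jump_poly momentZ//.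
  rewrite (moment_sum iw hf m (fun i => i.+1%:R * sin (i.+1%:R * th)) (fun i => cheb i.+1)).
  rewrite mulrCA [RHS]mulrC mulr_sumr; congr (_ * _); apply: eq_bigr => i _.
  by rewrite /b /ka /cheb_moment /=; ring.
have inv0 k : (m + k.+1)%:R^-1 @[m --> \oo] --> (0 : R).
  have := @cvg_shiftn k _ (@harmonic R) (nbhs (0 : R)).
  move=> E; have := @cvg_harmonic R; rewrite -E; apply: cvg_eq_fun => m.
  by rewrite /harmonic addnS.
have sg_cvg2 : sg m / (m + 2)%:R @[m --> \oo] --> l.
  have h1 : (fun=> 1 : R) m @[m --> \oo] --> (1 : R) by exact: cvg_cst.
  have h := cvgn_sub h1 (cvgn_mull (c := 2) (inv0 1%N)).
  have h2 := cvgn_mul sg_cvg h; rewrite mulr0 subr0 mulr1 in h2.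
  apply: cvg_near_eq_fun h2; near=> m.
  have m0 : m%:R != 0 :> R.
    by rewrite pnatr_eq0 -lt0n; near: m; exact: nbhs_infty_gt.
  have m2 : m%:R + 2 != 0 :> R by rewrite -natrD pnatr_eq0 addn2.
  by rewrite natrD; field; rewrite m0 m2.
(* The correction cancels the partial sums [sg m] in [Y m - Y m.+1], up to a
   term of order [sg m / m ^ 3]. *)
pose Y m := Q m.+1 - s * (sg m / (m.+1%:R * m.+2%:R)).
have Y0 : Y m @[m --> \oo] --> (0 : R).
  have h1 : Q m.+1 @[m --> \oo] --> (0 : R) by rewrite cvg_shiftS.
  have h2 := cvgn_mul sg_cvg2 (inv0 0%N); rewrite mulr0 in h2.
  have := cvgn_sub h1 (cvgn_mull (c := s) h2); rewrite mulr0 subr0.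
  apply: cvg_eq_fun => m; rewrite /Y !addnS addn0 invfM; congr (_ - _ * _).
  by rewrite -mulrA; congr (_ * _); rewrite mulrC.
(* The main term - s sin (n th) / n of the integral, with n = m + 1, is cancelled here up to a
   bounded remainder; multiplied by [ka m.+1] it tends to 0. *)
pose B m := m.+1%:R * m.+2%:R * \int[mu]_(t in `[-1, x]) (cheb m.+1).[t] +
  m.+1%:R * (s * sin (m.+1%:R * th)).
have stepE m : m.+1%:R * m.+2%:R * (Y m - Y m.+1) =
    ka m.+1 * B m - 2 * s * (sg m.+1 / (m.+1 + 2)%:R).
  have sgS : sg m.+1 = sg m + b m by rewrite /sg big_ord_recr.
  have := tail_primitive_step hP hf m.+1 hx'; rewrite -/(Q _) -/(Q _) -/(ka _) => step.
  have -> : Y m - Y m.+1 = (Q m.+1 - Q m.+2) - s * (sg m / (m.+1%:R * m.+2%:R)) +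
    s * (sg m.+1 / (m.+2%:R * m.+3%:R)) by rewrite /Y; ring.
  rewrite step /B sgS /b; set I := \int[mu]_(t in _) _.
  have n1 : m.+1%:R != 0 :> R by rewrite pnatr_eq0.
  have n2 : m.+2%:R != 0 :> R by rewrite pnatr_eq0.
  have n3 : m.+3%:R != 0 :> R by rewrite pnatr_eq0.
  rewrite addn2; move: n1 n2 n3; rewrite -(natr1 m.+2) -(natr1 m.+1) -(natr1 m).
  by move=> n1 n2 n3; field; rewrite n1 n2 n3.
(* With n = m + 1 one has n^2 - 1 = m (m + 2), so m > 0 is the condition n > 1 of [integral_cheb].
   The 6 is 2 * 3: (m + 1) / m <= 2, and [E] has three terms of size at most 1. *)
have B6 m : (0 < m)%N -> `|B m| <= 6.
  move=> m0; have := @integral_cheb m.+1 th m0 hth'; rewrite thE.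
  set I := \int[mu]_(t in _) _ => hI.
  have M0 : 1 <= m%:R :> R by rewrite ler1n.
  have mn0 : m%:R != 0 :> R by rewrite pnatr_eq0 -lt0n.
  pose E := - cos (m.+1%:R * pi) - x * cos (m.+1%:R * th) - s * sin (m.+1%:R * th).
  have -> : B m = m.+1%:R / m%:R * E.
    have -> : B m = m.+1%:R / m%:R * ((m.+1%:R ^+ 2 - 1) * I +
        m%:R * (s * sin (m.+1%:R * th))).
      by rewrite /B -/I -(natr1 m.+1) -(natr1 m); field.
    by rewrite hI /E -/s -(natr1 m); congr (_ * _); ring.
  have E3 : `|E| <= 3.
    have h1 : `|cos (m.+1%:R * pi) : R| <= 1 by exact: cos_max.
    have h2 : `|x * cos (m.+1%:R * th)| <= 1.
      by rewrite normrM -[leRHS]mulr1 ler_pM// ?cos_max// ler_norml.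
    have h3 : `|s * sin (m.+1%:R * th)| <= 1.
      by rewrite normrM -[leRHS]mulr1 ler_pM// sin_max.
    rewrite /E (le_trans (ler_normB _ _))//.
    by have := ler_normB (- cos (m.+1%:R * pi)) (x * cos (m.+1%:R * th)); rewrite normrN; lra.
  have q2 : `|m.+1%:R / m%:R : R| <= 2.
    rewrite ger0_norm// ler_pdivrMr ?ltr0n// -natr1; lra.
  by rewrite normrM (le_trans (ler_pM _ _ q2 E3))//; lra.
have kaB : ka m.+1 * B m @[m --> \oo] --> (0 : R).
  have h : `|ka m.+1| @[m --> \oo] --> (0 : R).
    by apply/norm_cvg0P; rewrite cvg_shiftS.
  have := cvgn_mull (c := 6) h; rewrite mulr0 => {}h.
  apply/norm_cvg0P; apply: (@squeeze_cvgr _ _ _ _ (fun=> 0)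
    (fun m => 6 * `|ka m.+1|)) => //; last exact: cvg_cst.
  near=> m; rewrite normr_ge0 normrM mulrC ler_wpM2r// B6//.
  by near: m; exact: nbhs_infty_gt.
have dY : m.+1%:R * m.+2%:R * (Y m - Y m.+1) @[m --> \oo] --> - (2 * s * l).
  have h1 : sg m.+1 / (m.+1 + 2)%:R @[m --> \oo] --> l.
    by rewrite (cvg_shiftS (fun m => sg m / (m + 2)%:R)).
  have := cvgn_sub kaB (cvgn_mull (c := 2 * s) h1); rewrite sub0r.
  by apply: cvg_eq_fun => m; rewrite stepE.
have hY := stolz Y0 dY.
have QS : m.+1%:R * Q m.+1 @[m --> \oo] --> - (s / pi) * jump f x.
  (* [Y] contributes - 2 s l, and restoring the correction subtracted in [Y] gives back s l. *)
  have -> : - (s / pi) * jump f x = - (2 * s * l) + s * l by rewrite /l; ring.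
  apply: cvg_eq_fun (cvgn_add hY (cvgn_mull (c := s) sg_cvg2)) => m.
  have n1 : m.+1%:R != 0 :> R by rewrite pnatr_eq0.
  have n2 : m.+2%:R != 0 :> R by rewrite pnatr_eq0.
  rewrite /Y addn2; move: n1 n2; rewrite -(natr1 m.+1) -(natr1 m) => n1 n2.
  by field; rewrite n1 n2.
rewrite /tail_detects_jump -sE -(cvg_shiftS (fun n => n%:R * Q n)).
exact: QS.
Unshelve. all: by end_near. Qed.

End JumpDetection.

Unset Implicit Arguments.

Theorem theorem3p4 (R : realType) (P : nat -> {poly R})
    (hP : chebyshev_orthonormal P) :
  (forall f : R -> R,
     HBV (-1) 1 f -> finite_set (discontinuities (-1) 1 f) ->
     forall x : R, -1 < x < 1 -> tail_detects_jump P f x)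
  /\
  (forall f : R -> R,
     V2 (-1) 1 f ->
     forall x : R, -1 < x < 1 -> tail_detects_jump P f x).
Proof.
split=> [f hf _|f /V2_HBV hf] x hx; exact: HBV_tail_detects_jump.
Qed.
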